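(* For any compact set $K\subset\mathbb{C}$, $S_N\to 1$ almost surely in $C(K)$ as $N\to\infty$, i.e. $$\sup_{z\in K}|S_N(z)-1|\to 0\quad\text{almost surely as } N\to\infty .$$
   Context: Let $\zeta_0,\zeta_1,\dots$ be i.i.d. standard complex Gaussian random variables $N_{\mathbb{C}}(0,1)$ (density $\pi^{-1}e^{-|\zeta|^2}$ on $\mathbb{C}$). Let $f_0(z)=\sum_{k=0}^\infty \zeta_k z^k/\sqrt{k!}$ (the Gaussian Entire Function) and, for $n\ge 0$, $$f_n(z,\bar z):=\frac{1}{\sqrt{n!}}(\partial_z-\bar z)^n f_0(z),\qquad \partial_z=\tfrac12(\partial_x-i\partial_y),\ z=x+iy .$$ Set $X_n(z):=e^{-|z|^2/2}f_n(z,\bar z)$ and $S_N(z):=\frac1N\sum_{n=0}^{N-1}|X_n(z)|^2$ for $z\in\mathbb{C}$, $N\ge 1$. $C(K)$ is the space of continuous functions on $K$ with the sup norm. *)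

(* Defs.v *)
From HB Require Import structures.
From mathcomp Require Import all_boot all_order all_algebra.
From mathcomp Require Import complex.
From mathcomp Require Import all_classical all_reals all_analysis.
Set Implicit Arguments.
Unset Strict Implicit.
Unset Printing Implicit Defensive.
Import Order.TTheory GRing.Theory Num.Theory.
Import numFieldNormedType.Exports.
Local Open Scope classical_set_scope.
Local Open Scope ring_scope.
Local Open Scope complex_scope.

(* The complex numbers are [R[i]]; the alias [R[i]^o] carries the topology of
   the modulus. Measurability in the plane is that of the product [R * R]
   through the coordinates. *)
Definition coords {R : realType} (z : R[i]) : R * R :=
  (complex.Re z, complex.Im z).

(* The real-valued modulus (the ring norm of [R[i]] takes values in [R[i]]). *)
Definition modulus {R : realType} (z : R[i]) : R := ComplexField.Normc.normc z.

Definition std_complex_gaussian_pdf {R : realType} (u : R * R) : R :=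
  pi^-1 * expR (- (u.1 ^+ 2 + u.2 ^+ 2)).

Definition is_std_complex_gaussian {R : realType} (d : measure_display)
    (T : measurableType d) (P : probability T R) (Z : T -> R[i]) : Prop :=
  measurable_fun setT (coords \o Z) /\
  forall A : set (R * R), measurable A ->
    P ((coords \o Z) @^-1` A) =
    (\int[(@lebesgue_measure R \x @lebesgue_measure R)%E]_(u in A)
        (std_complex_gaussian_pdf u)%:E)%E.

Definition mutually_independent {R : realType} (d : measure_display)
    (T : measurableType d) (P : probability T R) (Z : nat -> T -> R[i]) : Prop :=
  forall (s : seq nat) (A : nat -> set (R * R)), uniq s ->
    (forall k, measurable (A k)) ->
    P (\bigcap_(k in [set` s]) ((coords \o Z k) @^-1` A k)) =
    (\prod_(k <- s) P ((coords \o Z k) @^-1` A k))%E.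

(* Partial derivatives of a function on the plane, taken separately on the real
   and imaginary parts of its values. *)
Definition partial_x {R : realType} (g : R[i] -> R[i]) (z : R[i]) : R[i] :=
  let: x +i* y := z in
  derive1 (fun t : R => complex.Re (g (t +i* y))) x +i*
  derive1 (fun t : R => complex.Im (g (t +i* y))) x.

Definition partial_y {R : realType} (g : R[i] -> R[i]) (z : R[i]) : R[i] :=
  let: x +i* y := z in
  derive1 (fun t : R => complex.Re (g (x +i* t))) y +i*
  derive1 (fun t : R => complex.Im (g (x +i* t))) y.

Definition wirtinger {R : realType} (g : R[i] -> R[i]) (z : R[i]) : R[i] :=
  2^-1 * (partial_x g z - (0 +i* 1) * partial_y g z).

Definition dz_sub_conj {R : realType} (g : R[i] -> R[i]) (z : R[i]) : R[i] :=
  wirtinger g z - conjc z * g z.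

(* In the following, [c k] stands for a realization of the k-th coefficient. *)

(* Total definition: the value is meaningful where the series converges, which
   for the Gaussian coefficients is almost surely the whole plane. *)
Definition gef {R : realType} (c : nat -> R[i]) (z : R[i]) : R[i] :=
  limn (series (fun k => c k * z ^+ k / (Num.sqrt k`!%:R)%:C) : nat -> R[i]^o).

Definition gef_level {R : realType} (c : nat -> R[i]) (n : nat) (z : R[i]) :
    R[i] :=
  ((Num.sqrt n`!%:R)^-1)%:C * iter n dz_sub_conj (gef c) z.

Definition X_level {R : realType} (c : nat -> R[i]) (n : nat) (z : R[i]) :
    R[i] :=
  (expR (- (modulus z ^+ 2 / 2)))%:C * gef_level c n z.

Definition S_mean {R : realType} (c : nat -> R[i]) (N : nat) (z : R[i]) : R :=
  N%:R^-1 * \sum_(0 <= n < N) modulus (X_level c n z) ^+ 2.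

(* The supremum is taken in [0, +oo], so that it is 0 when K is empty. *)
Definition sup_norm {R : realType} (K : set R[i]) (g : R[i] -> R) : \bar R :=
  maxe 0%E (ereal_sup [set (`|g z|)%:E | z in K]).

(* Main.v *)
Require Import Defs.
From HB Require Import structures.
From mathcomp Require Import all_boot all_order all_algebra.
From mathcomp Require Import complex.
From mathcomp Require Import all_classical all_reals all_analysis.
From mathcomp Require Import measurable_realfun.
From mathcomp Require Import ring lra zify.
Import Order.TTheory GRing.Theory Num.Theory.
Import numFieldNormedType.Exports.
Local Open Scope classical_set_scope.
Local Open Scope ring_scope.
Local Open Scope complex_scope.

(* The map [X_n] is [exp(-|z|^2/2) f_n], and the ladder relations
   [(d_z - conj z) f_n = sqrt(n+1) f_(n+1)], [d_zbar f_n = - sqrt n f_(n-1)] make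
   [d_z (|X_n|^2)] a difference of consecutive terms: with
   [B_N = sum_(n<N) |X_n|^2] one gets [d_z B_N = sqrt N X_N conj(X_(N-1))], hence
   [|d_z B_N| <= sqrt N (|X_N|^2 + |X_(N-1)|^2) / 2]. Averaging over a window
   [N <= M < N + L] turns the right-hand side into [O(sqrt(N+L) B_(N+L) / L)],
   and [B_N] lies between consecutive window averages because it is monotone in
   [N]. With [L = N] this yields an a priori bound [B_N <= C N] on discs, and then
   with [L = N/m] that [B_N(z) - B_N(0)] is [o(N)] uniformly on discs.
   At the origin [X_n(0)] is the n-th Gaussian coefficient, so the only
   probabilistic input is the strong law of large numbers for the squared moduli
   of the coefficients; everything else holds for every realization that
   satisfies it. *)

Set Implicit Arguments.
Unset Strict Implicit.
Unset Printing Implicit Defensive.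

(** * The modulus on complex numbers *)

(** Windows are needed because a single [|X_N|^2] is controlled only by [B_(N+1)] itself, so the
    flux at one index could be of order [N^(3/2)]. A window of length [L] charges all its fluxes to
    the same mass [B_(N+L)] and then divides by [L], which leaves [O(sqrt N)] when [L] is comparable
    with [N]. The linear bound is self-improving: the variation estimate controls the mass at [N]
    through the mass at [2N], so some finite linear bound must exist beforehand, and an entire
    series offers none. Truncated series do: for a polynomial with [K] coefficients,
    [(d_z - conj z)^n] grows at most like [(K + r)^n] on the disc of radius [r], and [n!] beats its
    square. Truncation does not increase the masses at the origin, and the improved bound depends on
    those alone, so it survives [K -> oo]. All differentiation of masses takes place along rays
    [t |-> t z] with [0 <= t <= 1]. These stay in the disc, so the radius never has to grow during
    the iteration and the one-variable mean value theorem suffices. *)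

Lemma le_of_eq (R : numDomainType) (x y : R) : x = y -> x <= y.
Proof. by move=> ->. Qed.

Section modulus.
Context {R : realType}.
Implicit Types z w : R[i].

Lemma modulusE z : modulus z = Num.sqrt (complex.Re z ^+ 2 + complex.Im z ^+ 2).
Proof. by case: z. Qed.

Lemma sqr_modulus z : modulus z ^+ 2 = complex.Re z ^+ 2 + complex.Im z ^+ 2.
Proof. by rewrite modulusE sqr_sqrtr// addr_ge0// sqr_ge0. Qed.

Lemma modulus_ge0 z : 0 <= modulus z.
Proof. by rewrite modulusE sqrtr_ge0. Qed.

Lemma modulusD z w : modulus (z + w) <= modulus z + modulus w.
Proof. exact: le_normcD. Qed.

Lemma modulusN z : modulus (- z) = modulus z.
Proof. exact: normcN. Qed.

Lemma modulusB z w : modulus (z - w) <= modulus z + modulus w.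
Proof. by rewrite (le_trans (modulusD _ _))// modulusN. Qed.

Lemma modulusM z w : modulus (z * w) = modulus z * modulus w.
Proof. exact: ComplexField.Normc.normcM. Qed.

Lemma modulusV z : modulus z^-1 = (modulus z)^-1.
Proof. exact: ComplexField.Normc.normcV. Qed.

Lemma modulus0 : modulus (0 : R[i]) = 0.
Proof. exact: ComplexField.Normc.normc0. Qed.

Lemma modulus1 : modulus (1 : R[i]) = 1.
Proof. exact: ComplexField.Normc.normc1. Qed.

Lemma ler_dist_modulus z w : `|modulus z - modulus w| <= modulus (z - w).
Proof.
rewrite ler_norml lerNl opprB !lerBlDr; apply/andP; split.
  by rewrite -[X in modulus X <= _](subKr z) (le_trans (modulusB _ _))// addrC.
by rewrite -[X in modulus X <= _](subrK w) modulusD.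
Qed.

Lemma modulusX z n : modulus (z ^+ n) = modulus z ^+ n.
Proof.
by elim: n => [|n IH]; rewrite ?expr0 ?modulus1// !exprS modulusM IH.
Qed.

Lemma modulus_conj z : modulus (conjc z) = modulus z.
Proof. by case: z => a b; rewrite !modulusE /= sqrrN. Qed.

Lemma modulus_real (x : R) : modulus x%:C = `|x|.
Proof. by rewrite modulusE /= expr0n /= addr0 sqrtr_sqr. Qed.

Lemma modulus_nat n : modulus (n%:R : R[i]) = n%:R.
Proof. by rewrite -(rmorph_nat (real_complex R)) modulus_real ger0_norm. Qed.

Lemma Re_le_modulus z : `|complex.Re z| <= modulus z.
Proof. by rewrite modulusE -sqrtr_sqr ler_wsqrtr// lerDl sqr_ge0. Qed.

Lemma Im_le_modulus z : `|complex.Im z| <= modulus z.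
Proof. by rewrite modulusE -sqrtr_sqr ler_wsqrtr// lerDr sqr_ge0. Qed.

Lemma modulus_le_ReIm z : modulus z <= `|complex.Re z| + `|complex.Im z|.
Proof.
case: z => a b; rewrite (_ : a +i* b = a%:C + 'i * b%:C); last by simpc.
apply: (le_trans (modulusD _ _)); rewrite modulusM !modulus_real.
by rewrite (modulusE 'i) /= expr0n expr1n add0r sqrtr1 !(mul0r, mulr0, mul1r, subr0, addr0, add0r).
Qed.

Lemma ReD z w : complex.Re (z + w) = complex.Re z + complex.Re w.
Proof. by case: z; case: w. Qed.
Lemma ImD z w : complex.Im (z + w) = complex.Im z + complex.Im w.
Proof. by case: z; case: w. Qed.
Lemma ReN z : complex.Re (- z) = - complex.Re z. Proof. by case: z. Qed.
Lemma ImN z : complex.Im (- z) = - complex.Im z. Proof. by case: z. Qed.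
Lemma ReM z w : complex.Re (z * w) =
  complex.Re z * complex.Re w - complex.Im z * complex.Im w.
Proof. by case: z; case: w. Qed.
Lemma ImM z w : complex.Im (z * w) =
  complex.Re z * complex.Im w + complex.Im z * complex.Re w.
Proof. by case: z => a b; case: w => c d. Qed.

Lemma normC_modulus (z : R[i]^o) : `|z| = (modulus z)%:C.
Proof. by rewrite modulusE; exact: normc_def. Qed.

Lemma cvg_complex (u : nat -> R[i]^o) (l : R[i]) :
  modulus (u n - l) @[n --> \oo] --> 0 -> u n @[n --> \oo] --> (l : R[i]^o).
Proof.
move=> h; apply/cvgrPdist_lt => e e0.
have e0' := e0; move: e0'; rewrite ltcE /= => /andP[/eqP ie0 re0].
have ee : e = (complex.Re e)%:C by case: e ie0 {e0 re0} => a b /= ->.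
move/cvgrPdist_lt: h => /(_ _ re0) h.
near=> n; rewrite distrC normC_modulus ee ltcR.
have : `|0 - modulus (u n - l)| < complex.Re e by near: n.
by rewrite sub0r normrN ger0_norm// modulus_ge0.
Unshelve. all: by end_near. Qed.

Lemma cvg_modulus_lim (u : nat -> R[i]^o) (l : R[i]) :
  modulus (u n - l) @[n --> \oo] --> 0 -> limn u = l.
Proof. by move=> /cvg_complex; apply: cvg_lim; exact: norm_hausdorff. Qed.

End modulus.

(** * Complex series *)

Section complex_series.
Context {R : realType}.
Implicit Types (u v : nat -> R[i]) (s t : R[i]).

(** Phrased through the real-valued modulus so that limits are taken in [R]; [has_sum_lim] returns
    to the topology of [R[i]^o] in which [gef] is defined. *)
Definition has_sum u s : Prop :=
  modulus (series u n - s) @[n --> \oo] --> (0 : R).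

(** The fixed ratio 1/2 costs no generality for entire series: any other geometric factor is
    absorbed by enlarging the radius in [entire]. *)
Definition geom_dominated (M : R) u : Prop :=
  forall k, modulus (u k) <= M * 2^-1 ^+ k.

Lemma squeeze0 (f g : nat -> R) : (forall n, 0 <= f n <= g n) ->
  g n @[n --> \oo] --> 0 -> f n @[n --> \oo] --> 0.
Proof.
move=> fg g0; apply: (squeeze_cvgr _ (cvg_cst 0) g0).
exact: nearW.
Qed.

Lemma has_sumD u v s t : has_sum u s -> has_sum v t ->
  has_sum (fun k => u k + v k) (s + t).
Proof.
move=> us vt.
apply: (@squeeze0 _ (fun n => modulus (series u n - s) + modulus (series v n - t)));
  last first.
  rewrite -(addr0 (0 : R)); exact: cvgD us vt.
move=> n; rewrite modulus_ge0 /=.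
rewrite (_ : _ - (s + t) = series u n - s + (series v n - t)) ?modulusD//.
by rewrite /series/= big_split/= opprD addrACA.
Qed.

Lemma has_sumZ (c : R[i]) u s : has_sum u s ->
  has_sum (fun k => c * u k) (c * s).
Proof.
move=> us; rewrite /has_sum.
under eq_fun do rewrite /series/= -mulr_sumr -mulrBr modulusM.
rewrite -(mulr0 (modulus c)); exact: cvgMl_tmp.
Qed.

Lemma has_sum_lim u s : has_sum u s -> limn (series u : nat -> R[i]^o) = s.
Proof. exact: cvg_modulus_lim. Qed.

Lemma has_sum_unique u s t : has_sum u s -> has_sum u t -> s = t.
Proof. by move=> /has_sum_lim <- /has_sum_lim <-. Qed.

Lemma geom_partial_sum (M : R) n :
  \sum_(0 <= k < n) (M * 2^-1 ^+ k) = 2 * M * (1 - 2^-1 ^+ n).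
Proof.
elim: n => [|n IH]; first by rewrite big_geq// expr0 subrr mulr0.
rewrite big_nat_recr//= IH exprS; set q := 2^-1 ^+ n.
by field.
Qed.

Lemma has_sum_le (M : R) u s : geom_dominated M u -> has_sum u s ->
  modulus s <= 2 * M.
Proof.
move=> uM us.
have M0 : 0 <= M by have := uM 0%N; rewrite expr0 mulr1; apply: le_trans; exact: modulus_ge0.
have sn n : modulus (series u n) <= 2 * M.
  have : modulus (series u n) <= \sum_(0 <= k < n) (M * 2^-1 ^+ k).
    rewrite /series/=; elim: n => [|n IH]; first by rewrite !big_geq// modulus0.
    by rewrite !big_nat_recr//= (le_trans (modulusD _ _))// lerD.
  move/le_trans; apply; rewrite geom_partial_sum ler_piMr ?mulr_ge0// lerBlDr lerDl exprn_ge0.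
move: (us) => /cvgrPdist_lt h.
apply/ler_addgt0Pl => e e0; near \oo => n.
have : `|0 - modulus (series u n - s)| < e by near: n; exact: h.
rewrite sub0r normrN ger0_norm ?modulus_ge0// => hn.
have := modulusB (series u n) (series u n - s); rewrite subKr => /le_trans; apply.
by rewrite addrC lerD// ltW.
Unshelve. all: by end_near. Qed.

Lemma geom_real_cvg (M : R) (v : nat -> R) : (forall k, `|v k| <= M * 2^-1 ^+ k) ->
  cvgn (series v).
Proof.
move=> vM; apply: normed_cvg.
have g0 n : 0 <= geometric M 2^-1 n by rewrite (le_trans _ (vM n)).
apply: (series_le_cvg _ g0 vM) => //.
by apply: is_cvg_geometric_series; rewrite ger0_norm// invf_lt1// ltr1n.
Qed.

Lemma geom_dominated_has_sum (M : R) u : geom_dominated M u -> exists s, has_sum u s.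
Proof.
move=> uM.
have ReC : cvgn (series (fun k => complex.Re (u k))).
  by apply: (@geom_real_cvg M) => k; apply: le_trans (uM k); exact: Re_le_modulus.
have ImC : cvgn (series (fun k => complex.Im (u k))).
  by apply: (@geom_real_cvg M) => k; apply: le_trans (uM k); exact: Im_le_modulus.
set a := limn (series (fun k => complex.Re (u k))).
set b := limn (series (fun k => complex.Im (u k))).
exists (a +i* b).
have ReS n : complex.Re (series u n) = series (fun k => complex.Re (u k)) n.
  by rewrite /series/=; elim: n => [|n IH];
    [rewrite !big_geq|rewrite !big_nat_recr//= ReD IH].
have ImS n : complex.Im (series u n) = series (fun k => complex.Im (u k)) n.
  by rewrite /series/=; elim: n => [|n IH];
    [rewrite !big_geq|rewrite !big_nat_recr//= ImD IH].
apply: (@squeeze0 _ (fun n => `|series (fun k => complex.Re (u k)) n - a| +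
   `|series (fun k => complex.Im (u k)) n - b|)).
  move=> n; rewrite modulus_ge0 (le_trans (modulus_le_ReIm _))//.
  by rewrite !(ReD, ImD, ReN, ImN) /= ReS ImS.
have dist0 (f : nat -> R) (c : R) : f n @[n --> \oo] --> c ->
    `|f n - c| @[n --> \oo] --> 0.
  move=> fc; rewrite -(normr0 R) -(subrr c); apply: cvg_norm.
  exact: cvgB fc (cvg_cst c).
rewrite -(addr0 (0 : R)); exact: cvgD (dist0 _ _ ReC) (dist0 _ _ ImC).
Qed.

Definition csum u : R[i] := limn (series u : nat -> R[i]^o).

Lemma csumP (M : R) u : geom_dominated M u -> has_sum u (csum u).
Proof.
by move=> /geom_dominated_has_sum[s us]; rewrite /csum (has_sum_lim us).
Qed.

Lemma has_sum_finite u n : (forall k, (n <= k)%N -> u k = 0) -> has_sum u (series u n).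
Proof.
move=> u0; apply/cvgrPdist_lt => e e0; near=> m.
suff -> : series u m = series u n by rewrite subrr modulus0 subrr normr0.
have nm : (n <= m)%N by near: m; exact: nbhs_infty_ge.
rewrite /series/= (big_cat_nat (leq0n n) nm)//= [X in _ + X]big1_seq ?addr0// => k.
by rewrite mem_index_iota => /andP[_ /andP[nk _]]; rewrite u0.
Unshelve. all: by end_near. Qed.

End complex_series.

(** * Wirtinger derivatives *)

Section planar_differentiability.
Context {R : realType}.
Implicit Types (g : R[i] -> R[i]) (z w : R[i]).

(* [a] and [b] are the derivatives in [z] and [conj z]. All functions considered
   are smooth, so the remainder is asked to be quadratic rather than [o(|h|)]. *)
Definition has_wirtinger g z (a b : R[i]) : Prop :=
  exists C delta : R, 0 < delta /\ forall h, modulus h <= delta ->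
    modulus (g (z + h) - g z - (a * h + b * conjc h)) <= C * modulus h ^+ 2.

Lemma has_wirtingerB g1 g2 z a1 b1 a2 b2 :
  has_wirtinger g1 z a1 b1 -> has_wirtinger g2 z a2 b2 ->
  has_wirtinger (fun w => g1 w - g2 w) z (a1 - a2) (b1 - b2).
Proof.
move=> [C1 [d1 [d10 H1]]] [C2 [d2 [d20 H2]]].
exists (C1 + C2), (Num.min d1 d2); split; first by rewrite lt_min d10.
move=> h; rewrite le_min => /andP[/H1 {}H1 /H2 {}H2].
set x1 := (X in modulus X <= _) in H1; set x2 := (X in modulus X <= _) in H2.
rewrite [X in modulus X <= _](_ : _ = x1 - x2); last by rewrite /x1 /x2; ring.
by rewrite (le_trans (modulusB _ _))// mulrDl lerD.
Qed.

Lemma has_wirtinger_conjM g z a b : has_wirtinger g z a b ->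
  has_wirtinger (fun w => conjc w * g w) z
    (conjc z * a) (conjc z * b + g z).
Proof.
move=> [C [d [d0 H]]].
exists ((modulus z + d) * C + (modulus a + modulus b)), d; split => // h hd.
have {}H := H h hd; set x := (X in modulus X <= _) in H.
(* The remainder of the product is [conj (z + h)] times the remainder of [g], plus a cross term that
   is already of second order in [h]. *)
rewrite [X in modulus X <= _](_ : _ =
  conjc (z + h) * x + conjc h * (a * h + b * conjc h)); last first.
  by rewrite /x rmorphD/=; ring.
rewrite (le_trans (modulusD _ _))// mulrDl lerD//.
  rewrite modulusM modulus_conj -mulrA ler_pM ?modulus_ge0//.
  by rewrite (le_trans (modulusD _ _))// lerD2l.
rewrite modulusM modulus_conj expr2 mulrCA ler_wpM2l ?modulus_ge0//.
by rewrite (le_trans (modulusD _ _))// !modulusM modulus_conj mulrDl.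
Qed.

Lemma is_derive_quadratic (phi : R -> R) (x l C delta : R) : 0 < delta ->
  (forall s, `|s| <= delta -> `|phi (x + s) - phi x - s * l| <= C * s ^+ 2) ->
  is_derive x 1 phi l.
Proof.
move=> d0 H.
have lim_l : h^-1 *: (phi (h *: 1 + x) - phi x) @[h --> 0^'] --> l.
  apply/cvgrPdist_le => e e0; near=> h.
  have h0 : h != 0 by near: h; exact: nbhs_dnbhs_neq.
  have hd : `|h| <= delta.
    near: h; apply: nbhs_dnbhs; apply/nbhs_normP; exists delta => //= y /=.
    by rewrite sub0r normrN => /ltW.
  (* The sign of [C] is unknown, hence the absolute value; the added 1 keeps the denominator
     positive. *)
  have he : `|h| <= e / (`|C| + 1).
    near: h; apply: nbhs_dnbhs; apply/nbhs_normP.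
    exists (e / (`|C| + 1)); first by rewrite /= divr_gt0// ltr_wpDl.
    by move=> y /=; rewrite sub0r normrN => /ltW.
  rewrite distrC scaler1 (addrC h) /GRing.scale/=.
  rewrite [X in `|X| <= _](_ : _ = h^-1 * (phi (x + h) - phi x - h * l)); last by field.
  rewrite normrM normfV ler_pdivrMl ?normr_gt0// (le_trans (H _ hd))//.
  rewrite -normr_id -real_normK ?num_real// expr2 mulrCA.
  rewrite normr_id ler_wpM2l// (le_trans (ler_norm _))// normrM normr_id.
  rewrite (le_trans (ler_wpM2l _ he))// mulrA ler_pdivrMr ?ltr_wpDl//.
  by rewrite mulrC ler_wpM2l ?(ltW e0)// lerDl.
apply: DeriveDef; first by apply/cvg_ex; exists l.
exact: cvg_lim lim_l.
Unshelve. all: by end_near. Qed.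

(** Directional derivative along any real line: the directions 1 and ['i] give the two partial
    derivatives, and the direction [z] gives the ray through [z] on which masses are
    differentiated. *)
Lemma has_wirtinger_line g z a b (v : R[i]) (p : R -> R[i]) x :
  has_wirtinger g z a b -> p x = z -> (forall s, p (x + s) = p x + s%:C * v) ->
  is_derive x 1 (fun t => complex.Re (g (p t))) (complex.Re (a * v + b * conjc v)) /\
  is_derive x 1 (fun t => complex.Im (g (p t))) (complex.Im (a * v + b * conjc v)).
Proof.
move=> [C [d [d0 H]]] px ps.
have v1 : 0 < modulus v + 1 by rewrite ltr_wpDl ?modulus_ge0.
have key s : `|s| <= d / (modulus v + 1) ->
    modulus (g (p (x + s)) - g (p x) - s%:C * (a * v + b * conjc v)) <=
    C * modulus v ^+ 2 * s ^+ 2.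
  move=> sd; rewrite ps px.
  have sv : modulus (s%:C * v) <= d.
    rewrite modulusM modulus_real (le_trans (ler_wpM2r (modulus_ge0 _) sd))//.
    by rewrite mulrAC ler_pdivrMr// ler_wpM2l ?(ltW d0)// lerDl.
  have := H _ sv; rewrite modulusM modulus_real exprMn real_normK ?num_real//.
  rewrite -mulrA (mulrC (s ^+ 2)); congr (modulus _ <= _).
  have -> : conjc (s%:C * v) = s%:C * conjc v.
    by case: (v) => r1 r2; apply/eqP; rewrite eq_complex /=; apply/andP; split;
      apply/eqP; ring.
  ring.
have dv : 0 < d / (modulus v + 1) by rewrite divr_gt0.
split; apply: (is_derive_quadratic dv (C := C * modulus v ^+ 2)) => s /key;
  apply: le_trans.
- rewrite (le_trans _ (Re_le_modulus _))// !(ReD, ReN, ReM)/=.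
  by rewrite mul0r subr0.
- rewrite (le_trans _ (Im_le_modulus _))// !(ImD, ImN, ImM)/=.
  by rewrite mul0r addr0.
Qed.

(** The derivatives along 1 and ['i] are [a + b] and [i (a - b)], so half of the first minus [i]
    times the second is [a]. *)
Lemma has_wirtinger_wirtinger g z a b :
  has_wirtinger g z a b -> wirtinger g z = a.
Proof.
case: z => x y gz.
have [dx1 dx2] := @has_wirtinger_line g _ a b 1 (fun t => t +i* y) x gz erefl
  (fun s => ltac:(by simpc)).
have [dy1 dy2] := @has_wirtinger_line g _ a b 'i (fun t => x +i* t) y gz erefl
  (fun s => ltac:(by simpc)).
rewrite /wirtinger /partial_x /partial_y !derive1E.
rewrite (@derive_val _ _ _ _ _ _ _ dx1) (@derive_val _ _ _ _ _ _ _ dx2).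
rewrite (@derive_val _ _ _ _ _ _ _ dy1) (@derive_val _ _ _ _ _ _ _ dy2).
clear; case: a => a1 a2; case: b => b1 b2 /=.
apply: (@mulfI _ 2%:R); first by rewrite pnatr_eq0.
rewrite mulrA mulfV ?pnatr_eq0// mul1r mulr_natl mulr2n.
by apply/eqP; rewrite eq_complex /=; apply/andP; split; apply/eqP; ring.
Qed.

End planar_differentiability.

(** * Levels of an entire series *)

Section levels.
Context {R : realType}.
Implicit Types (a : nat -> R[i]) (z h : R[i]).

(** Infinite radius of convergence, as geometric domination at every radius; this form is stable
    under termwise differentiation, which only changes [rho]. *)
Definition entire a : Prop :=
  forall rho : R, 0 <= rho -> exists M : R,
    forall k, modulus (a k) * rho ^+ k <= M * 2^-1 ^+ k.

(** Terms of the [j]-th derivative of the power series. For [k < j] the falling factorial vanishes,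
    so the truncated exponent [k - j] is harmless. *)
Definition pow_deriv a (j : nat) z : nat -> R[i] :=
  fun k => a k * (k ^_ j)%:R * z ^+ (k - j).

Definition fser a (j : nat) z : R[i] := csum (pow_deriv a j z).

(** A crude bound, but geometric in [k]: differentiating [j] times then costs only a factor [2 ^ j]
    in the radius. *)
Lemma ffact_le (k j : nat) : (k ^_ j <= (2 ^ j) ^ k)%N.
Proof.
elim: j => [|j IH]; first by rewrite exp1n.
rewrite ffactnSr expnS expnMn mulnC leq_mul//.
by rewrite (leq_trans (leq_subr _ _))// ltnW// ltn_expl.
Qed.

Lemma pow_deriv_dominated a j r : entire a -> 1 <= r ->
  exists M : R, forall z, modulus z <= r -> geom_dominated M (pow_deriv a j z).
Proof.
move=> ea r1.
have r0 : 0 <= r by rewrite (le_trans ler01).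
have [|M HM] := ea (2%:R ^+ j * r); first by rewrite mulr_ge0// exprn_ge0.
exists M => z zr k; rewrite (le_trans _ (HM k))// /pow_deriv !modulusM.
rewrite -mulrA ler_wpM2l ?modulus_ge0// modulus_nat modulusX exprMn ler_pM//.
- by rewrite exprn_ge0// modulus_ge0.
- by rewrite -!natrX ler_nat ffact_le.
- rewrite (le_trans (lerXn2r _ _ _ zr)) ?nnegrE ?modulus_ge0//.
  by rewrite ler_weXn2l// leq_subr.
Qed.

Lemma fserP a j z : entire a -> has_sum (pow_deriv a j z) (fser a j z).
Proof.
move=> ea; have z1 : 1 <= modulus z + 1 by rewrite lerDr modulus_ge0.
have [M HM] := pow_deriv_dominated j ea z1.
by apply: csumP (HM z _); rewrite lerDl.
Qed.

(** By induction on [m]: the new remainder is [(z + h)] times the old one plus [m z^(m-1) h^2]. Each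
    part costs a factor [r], the second by [m <= 2 ^ m]. The constant is again geometric in [m], so
    it can be summed against the coefficients. *)
Lemma exprD_remainder (r : R) z h m : 1 <= r -> modulus z <= r ->
  modulus (z + h) <= r ->
  modulus ((z + h) ^+ m - z ^+ m - m%:R * z ^+ m.-1 * h) <=
  (2 * r) ^+ m * modulus h ^+ 2.
Proof.
move=> r1 zr zhr; have r0 : 0 <= r by rewrite (le_trans ler01).
elim: m => [|m IH].
  by rewrite !expr0 subrr !mul0r subr0 modulus0 mul1r sqr_ge0.
set x := (X in modulus X <= _) in IH.
rewrite [X in modulus X <= _](_ : _ = (z + h) * x + m%:R * z ^+ m.-1 * h ^+ 2);
  last first.
  rewrite /x !exprS; case: m {IH x} => [|m] /=; rewrite ?exprS -?natr1; ring.
rewrite (le_trans (modulusD _ _))//.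
have -> : (2 * r) ^+ m.+1 * modulus h ^+ 2 =
  r * ((2 * r) ^+ m * modulus h ^+ 2) + r * (2 * r) ^+ m * modulus h ^+ 2.
  by rewrite exprS; ring.
rewrite lerD//; first by rewrite modulusM ler_pM ?modulus_ge0.
rewrite !modulusM !modulusX modulus_nat -expr2 ler_wpM2r ?sqr_ge0//.
rewrite exprMn mulrCA ler_pM ?exprn_ge0 ?modulus_ge0//.
  by rewrite -natrX ler_nat ltnW// ltn_expl.
rewrite (le_trans (lerXn2r _ _ _ zr)) ?nnegrE ?modulus_ge0//.
by rewrite -exprS ler_weXn2l// (leq_trans (leq_pred _)).
Qed.

Lemma has_wirtinger_fser a j z : entire a ->
  has_wirtinger (fser a j) z (fser a j.+1 z) 0.
Proof.
move=> ea; pose r := modulus z + 1.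
have r1 : 1 <= r by rewrite lerDr modulus_ge0.
have r0 : 0 <= r by rewrite (le_trans ler01).
(* The factor [2 ^ j] pays for the falling factorial, and [2 * r] for the Taylor remainder of the
   powers on the disc of radius [r]. *)
have [|M HM] := ea (2%:R ^+ j * (2 * r)).
  by rewrite mulr_ge0 ?exprn_ge0// mulr_ge0.
exists (2 * M), 1; split => // h h1.
have hsum := has_sumD (has_sumD (fserP j (z + h) ea)
  (has_sumZ (-1) (fserP j z ea))) (has_sumZ (- h) (fserP j.+1 z ea)).
have dom : geom_dominated (M * modulus h ^+ 2) (fun k => pow_deriv a j (z + h) k
    + -1 * pow_deriv a j z k + - h * pow_deriv a j.+1 z k).
  move=> k; rewrite /pow_deriv ffactnSr natrM subnS.
  pose E := (z + h) ^+ (k - j) - z ^+ (k - j) - (k - j)%:R * z ^+ (k - j).-1 * h.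
  rewrite [X in modulus X <= _](_ : _ = a k * (k ^_ j)%:R * E);
    last by rewrite /E; ring.
  have zr : modulus z <= r by rewrite lerDl.
  have zhr : modulus (z + h) <= r by rewrite (le_trans (modulusD _ _))// lerD2l.
  have := exprD_remainder (k - j) r1 zr zhr; rewrite -/E => rem.
  rewrite 2!modulusM modulus_nat mulrAC.
  apply: (@le_trans _ _ (modulus (a k) * (2 ^+ j * (2 * r)) ^+ k * modulus h ^+ 2)).
    rewrite mulrAC -!mulrA ler_wpM2l ?modulus_ge0// exprMn -mulrA.
    rewrite ler_pM ?modulus_ge0//.
      by rewrite -!natrX ler_nat ffact_le.
    rewrite (le_trans rem)// ler_wpM2r ?sqr_ge0// ler_weXn2l ?leq_subr//.
    by rewrite (le_trans r1)// ler_peMl// ler1n.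
  by rewrite [leRHS]mulrAC ler_wpM2r ?sqr_ge0.
have := has_sum_le dom hsum; rewrite mulrA mulN1r mulNr (mulrC h).
by rewrite mul0r addr0.
Qed.

(* [level a n j] is [(d_z - conj z)^n] applied to the [j]-th derivative of the
   series; carrying [j] makes the ladder relations provable by induction on [n]. *)
Fixpoint level a (n j : nat) z : R[i] :=
  if n is n'.+1 then level a n' j.+1 z - conjc z * level a n' j z
  else fser a j z.

(** Ladder relations without normalization. The derivative in [conj z] kills the series and commutes
    with [d_z - conj z] up to [-1], so each of the [n] factors contributes one [-1]. At [n = 0] the
    index [n.-1] is multiplied by zero. *)
Lemma has_wirtinger_level a n j z : entire a ->
  has_wirtinger (level a n j) z (level a n j.+1 z)
    (- n%:R * level a n.-1 j z).
Proof.
move=> ea; elim: n j => [|n IH] j /=.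
  by rewrite oppr0 mul0r; exact: has_wirtinger_fser.
have := has_wirtingerB (IH j.+1) (has_wirtinger_conjM (IH j)).
congr has_wirtinger; case: n {IH} => [|n] /=; rewrite ?oppr0 ?mul0r ?mulr0.
  by ring.
by rewrite -!natr1; ring.
Qed.

(** At the origin the [conj z] terms disappear, so a level there is a plain Taylor derivative. *)
Lemma level_at0 a n j : entire a -> level a n j 0 = (n + j)`!%:R * a (n + j)%N.
Proof.
move=> ea; elim: n j => [|n IH] j.
  apply: has_sum_unique (fserP j 0 ea) _.
  have -> : j`!%:R * a j = series (pow_deriv a j 0) j.+1.
    rewrite /series /= big_nat_recr//= big1_seq ?add0r.
      by rewrite /pow_deriv ffactnn subnn expr0 mulr1 mulrC.
    move=> k; rewrite mem_index_iota => /andP[_ /andP[_ kj]].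
    by rewrite /pow_deriv ffact_small// mulr0 mul0r.
  apply: has_sum_finite => k jk.
  by rewrite /pow_deriv expr0n subn_eq0 leqNgt jk mulr0.
rewrite [LHS](_ : _ = level a n j.+1 0 - conjc 0 * level a n j 0)//.
by rewrite conjc0 mul0r subr0 IH addnS.
Qed.

End levels.

(** * Energy flux *)

Section energy_flux.
Context {R : realType}.
Implicit Types (a : nat -> R[i]) (z : R[i]).

(** This is [|X_n(z)|^2] for the series with coefficients [a]; [mass] is accordingly the sum
    [B_N]. *)
Definition intensity a n z : R :=
  expR (- modulus z ^+ 2) * modulus (level a n 0 z) ^+ 2 / n`!%:R.

Definition mass a N z : R := \sum_(0 <= n < N) intensity a n z.

(* The factor [n / n!] is [1 / (n-1)!] for [n > 0] and kills the junk index
   [n.-1] at [n = 0]. *)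
Definition flux a n z (t : R) : R :=
  2 * expR (- modulus (t%:C * z) ^+ 2) *
  complex.Re (z * level a n 0 (t%:C * z) * conjc (level a n.-1 0 (t%:C * z))) *
  (n%:R / n`!%:R).

Lemma intensity_ge0 a n z : 0 <= intensity a n z.
Proof. by rewrite divr_ge0// mulr_ge0 ?expR_ge0// sqr_ge0. Qed.

Lemma mass_ge0 a N z : 0 <= mass a N z.
Proof. by apply: sumr_ge0 => n _; exact: intensity_ge0. Qed.

Lemma mass_le a N M z : (N <= M)%N -> mass a N z <= mass a M z.
Proof.
move=> NM; rewrite /mass (big_cat_nat (leq0n N) NM)//= lerDl.
by apply: sumr_ge0 => n _; exact: intensity_ge0.
Qed.

(** Write [g_n] for the level and [w = t z]. The derivative along the ray is [2 Re (z d_w)] of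
    [exp(-|w|^2) |g_n|^2 / n!]. Since [d_w g_n = g_(n+1) + conj w g_n], the weight cancels the
    [conj w] term. What remains is [g_(n+1) conj g_n - n g_n conj g_(n-1)], with its two terms of
    the same shape at consecutive indices. *)
Lemma is_derive_intensity a n z (t : R) : entire a ->
  is_derive t 1 (fun s => intensity a n (s%:C * z))
    (flux a n.+1 z t - flux a n z t).
Proof.
move=> ea.
have ps (s : R) : (t + s)%:C * z = t%:C * z + s%:C * z.
  by rewrite (rmorphD (real_complex R)) mulrDl.
have [dU dV] := @has_wirtinger_line R (level a n 0) (t%:C * z) _ _ z
  (fun s => s%:C * z) t (has_wirtinger_level n 0 (t%:C * z) ea) erefl
  ps.
set U := (fun _ => _) in dU; set V := (fun _ => _) in dV.
pose m := modulus z ^+ 2.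
have dq : is_derive t 1 (fun s : R => - (s ^+ 2 * m)) (- (2 * t * m)).
  have h := is_deriveN (is_deriveM (is_deriveX 2 (is_derive_id t 1)) (is_derive_cst m t 1)).
  apply: is_derive_eq h _.
  by rewrite scaler0 add0r /GRing.scale/= /cst; ring.
have dE := @is_derive1_comp R expR (fun s => - (s ^+ 2 * m)) t _ _
  (is_derive_expR _) dq.
have dsq := is_deriveD (is_deriveX 2 dU) (is_deriveX 2 dV).
have h := is_deriveM (is_deriveM dE dsq) (is_derive_cst ((n`!%:R)^-1 : R) t 1).
have -> : (fun s => intensity a n (s%:C * z)) = (fun s =>
    expR (- (s ^+ 2 * m)) * (U s ^+ 2 + V s ^+ 2) * n`!%:R^-1).
  apply/funext => s; rewrite /intensity modulusM modulus_real exprMn.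
  by rewrite real_normK ?num_real// (sqr_modulus (level _ _ _ _)).
apply: is_derive_eq h _.
rewrite /flux modulusM modulus_real exprMn real_normK ?num_real// -/m.
have -> : n.+1%:R / n.+1`!%:R = (n`!%:R)^-1 :> R.
  by rewrite factS natrM invfM mulrA mulfV ?mul1r// pnatr_eq0.
have -> : level a n 1 (t%:C * z) =
    level a n.+1 0 (t%:C * z) + conjc (t%:C * z) * level a n 0 (t%:C * z).
  by rewrite /= subrK.
clear; rewrite /U /V {U V}; move: (level a n.+1 0 _) => g1.
rewrite !scaler0 add0r /GRing.scale/= /cst.
rewrite /m sqr_modulus.
rewrite [X in n`!%:R^-1 * (_ + X * _)](_ : _ = complex.Re (level a n 0 (t%:C * z)) ^+ 2 +
  complex.Im (level a n 0 (t%:C * z)) ^+ 2)//.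
rewrite -(rmorph_nat (real_complex R) n).
move: (expR _) (n`!%:R^-1) (level a n 0 _) (level a n.-1 0 _) => e c g0 gm.
clear m; case: g0 g1 gm z => [u0 v0] [u1 v1] [um vm] [x y] /=.
ring.
Qed.

Lemma is_derive_mass a N z (t : R) : entire a ->
  is_derive t 1 (fun s => mass a N (s%:C * z)) (flux a N z t).
Proof.
move=> ea; elim: N => [|N IH].
  have -> : (fun s => mass a 0 (s%:C * z)) = cst 0.
    by apply/funext => s; rewrite /mass big_geq.
  by rewrite /flux mul0r mulr0; exact: is_derive_cst.
have -> : (fun s => mass a N.+1 (s%:C * z)) =
    (fun s => mass a N (s%:C * z)) + (fun s => intensity a N (s%:C * z)).
  by apply/funext => s; rewrite /mass big_nat_recr.
by apply: is_derive_eq (is_deriveD IH (is_derive_intensity N z t ea)) _; rewrite addrC subrK.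
Qed.

(** Weighted arithmetic-geometric inequality [2 p q <= p^2 / s + s q^2] with [s] the square root of
    the upper index; this weight balances the normalizations [1/N!] and [1/(N-1)!] of the two
    neighbouring intensities. *)
Lemma flux_le a N z (t : R) : (0 < N)%N ->
  `|flux a N z t| <= modulus z * Num.sqrt N%:R *
    (intensity a N (t%:C * z) + intensity a N.-1 (t%:C * z)).
Proof.
case: N => // N _ /=; rewrite /flux /intensity /=.
set w := t%:C * z; set e := expR _; set g1 := level a N.+1 0 w; set g0 := level a N 0 w.
have e0 : 0 <= e by exact: expR_ge0.
have nn : N.+1%:R / N.+1`!%:R = (N`!%:R)^-1 :> R.
  by rewrite factS natrM invfM mulrA mulfV ?mul1r// pnatr_eq0.
rewrite nn factS natrM invfM.
set c := (N`!%:R)^-1; set s := Num.sqrt N.+1%:R.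
have c0 : 0 <= c by rewrite invr_ge0.
have s0 : 0 < s by rewrite sqrtr_gt0.
have ss : N.+1%:R = s * s :> R by rewrite -expr2 sqr_sqrtr.
have hRe : `|complex.Re (z * g1 * conjc g0)| <= modulus z * (modulus g1 * modulus g0).
  by rewrite (le_trans (Re_le_modulus _))// !modulusM modulus_conj mulrA.
rewrite !normrM (ger0_norm e0) (ger0_norm c0) ger0_norm//.
apply: (@le_trans _ _ (2 * e * (modulus z * (modulus g1 * modulus g0)) * c)).
  by rewrite ler_wpM2r// ler_wpM2l// mulr_ge0.
rewrite ss invfM.
set p := modulus g1; set q := modulus g0; set m := modulus z.
have -> : m * s * (e * p ^+ 2 * (s^-1 / s * c) + e * q ^+ 2 * c) =
    m * e * c * (p ^+ 2 / s + s * q ^+ 2) by field; rewrite gt_eqF.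
rewrite [leLHS](_ : _ = m * e * c * (2 * p * q)); last by ring.
rewrite ler_wpM2l ?mulr_ge0 ?modulus_ge0//.
rewrite -subr_ge0.
have -> : p ^+ 2 / s + s * q ^+ 2 - 2 * p * q = s^-1 * (p - s * q) ^+ 2.
  by field; rewrite gt_eqF.
by rewrite mulr_ge0 ?sqr_ge0// invr_ge0 ltW.
Qed.

Definition mass_avg a N L z : R := L%:R^-1 * \sum_(N <= M < N + L) mass a M z.

Lemma mass_avg_bounds a N L z : (0 < L)%N ->
  mass a N z <= mass_avg a N L z <= mass a (N + L) z.
Proof.
move=> L0; have L0' : 0 < L%:R :> R by rewrite ltr0n.
rewrite /mass_avg mulrC ler_pdivlMr// ler_pdivrMr//.
have cstE (x : R) : x * L%:R = \sum_(N <= M < N + L) x.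
  by rewrite sumr_const_nat addKn mulr_natr.
rewrite !cstE !big_nat; apply/andP; split; apply: ler_sum => M /andP[NM ML].
- exact: mass_le.
- by apply: mass_le; exact: ltnW.
Qed.

(** The square root is replaced by its value at the end of the window. The intensities at [M] and at
    [M.-1] run over two windows, each contained in the indices below [N + L], whence the factor
    2. *)
Lemma sum_flux_le a N L z (t : R) : (0 < N)%N ->
  `|\sum_(N <= M < N + L) flux a M z t| <=
  2 * modulus z * Num.sqrt (N + L)%:R * mass a (N + L) (t%:C * z).
Proof.
move=> N0; rewrite (le_trans (ler_norm_sum _ _ _))//.
set c := modulus z * Num.sqrt (N + L)%:R.
apply: (@le_trans _ _ (\sum_(N <= M < N + L)
   (c * (intensity a M (t%:C * z) + intensity a M.-1 (t%:C * z))))).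
  rewrite !big_nat; apply: ler_sum => M /andP[NM ML].
  rewrite (le_trans (flux_le _ _ _ (leq_trans N0 NM)))//.
  rewrite ler_wpM2r ?addr_ge0 ?intensity_ge0// ler_wpM2l ?modulus_ge0//.
  by rewrite ler_wsqrtr// ler_nat ltnW.
rewrite -mulr_sumr -/c -mulrA -mulrA (mulrA (modulus z)) -/c mulrCA.
rewrite ler_wpM2l ?mulr_ge0 ?modulus_ge0 ?sqrtr_ge0//.
rewrite big_split/= mulr_natl mulr2n lerD//.
  rewrite /mass (big_cat_nat (leq0n N) (leq_addr L N))//= lerDr.
  by apply: sumr_ge0 => n _; exact: intensity_ge0.
case: N N0 {c} => // N _; rewrite big_add1/= addSn /=.
rewrite (le_trans _ (mass_le _ _ (leqnSn _)))//.
rewrite /mass (big_cat_nat (leq0n N) (leq_addr L N))//= lerDr.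
by apply: sumr_ge0 => n _; exact: intensity_ge0.
Qed.

(** Mean value theorem on the segment from 0 to [z]. The intermediate point is unknown, so [Q] has
    to bound the mass on the whole segment. *)
Lemma mass_avg_variation a N L z (Q : R) : entire a -> (0 < N)%N -> (0 < L)%N ->
  (forall t, 0 <= t <= 1 -> mass a (N + L) (t%:C * z) <= Q) ->
  `|mass_avg a N L z - mass_avg a N L 0| <=
    2 * modulus z * Num.sqrt (N + L)%:R * Q / L%:R.
Proof.
move=> ea N0 L0 HQ.
pose F (t : R) := \sum_(N <= M < N + L) mass a M (t%:C * z).
have dF (t : R) : is_derive t 1 F (\sum_(N <= M < N + L) flux a M z t).
  rewrite /F; elim: L {L0 HQ F} => [|L IH].
    rewrite addn0 !big_geq//.
    rewrite (_ : (fun _ => _) = cst 0); first exact: is_derive_cst.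
    by apply/funext => s; rewrite big_geq.
  rewrite addnS big_nat_recr ?leq_addr//=.
  rewrite (_ : (fun _ => _) = (fun t : R => \sum_(N <= M < N + L) mass a M (t%:C * z)) +
     (fun s => mass a (N + L) (s%:C * z))); last first.
    by apply/funext => s; rewrite big_nat_recr ?leq_addr.
  exact: is_deriveD IH (is_derive_mass (N + L) z t ea).
have cF : {within `[0, 1], continuous F}.
  apply: continuous_subspaceT => t; apply: differentiable_continuous.
  by apply/derivable1_diffP; exact: (@ex_derive _ _ _ _ _ _ _ (dF t)).
have [c c01 Fc] := MVT_segment ler01 (fun x _ => dF x) cF.
rewrite subr0 mulr1 in Fc.
rewrite /mass_avg.
have F1 : F 1 = \sum_(N <= M < N + L) mass a M z by rewrite /F mul1r.
have F0 : F 0 = \sum_(N <= M < N + L) mass a M 0 by rewrite /F mul0r.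
rewrite -F1 -F0 -mulrBr Fc mulrC normrM [X in _ * X]ger0_norm ?invr_ge0//.
rewrite ler_wpM2r ?invr_ge0// (le_trans (sum_flux_le _ _ _ _ N0))//.
rewrite ler_wpM2l ?mulr_ge0 ?modulus_ge0 ?sqrtr_ge0//.
by apply: HQ; move: c01; rewrite in_itv.
Qed.

End energy_flux.

(** * Uniform convergence for one realization *)

Section linear_growth.
Context {R : realType}.
Implicit Types (a : nat -> R[i]) (z : R[i]).

(** Polynomial approximations, which supply the finite linear bound from which the self-improvement
    starts. *)
Definition truncate K a : nat -> R[i] := fun k => if (k < K)%N then a k else 0.

Lemma entire_truncate K a : entire a -> entire (truncate K a).
Proof.
move=> ea rho rho0; have [M HM] := ea rho rho0; exists M => k.
rewrite /truncate; case: ifP => // _; rewrite modulus0 mul0r.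
by rewrite (le_trans _ (HM k))// mulr_ge0 ?exprn_ge0 ?modulus_ge0.
Qed.

Lemma fser_truncate K a j z :
  entire a -> fser (truncate K a) j z = series (pow_deriv a j z) K.
Proof.
move=> ea; apply: has_sum_unique (fserP j z (entire_truncate K ea)) _.
rewrite (_ : series _ K = series (pow_deriv (truncate K a) j z) K).
  apply: has_sum_finite => k Kk.
  by rewrite /pow_deriv /truncate ltnNge Kk !mul0r.
rewrite /series/= !big_nat; apply: eq_bigr => k /andP[_ kK].
by rewrite /pow_deriv /truncate kK.
Qed.

Lemma cvg_level_truncate a n j z : entire a ->
  modulus (level (truncate K a) n j z - level a n j z) @[K --> \oo] --> (0 : R).
Proof.
move=> ea; elim: n j => [|n IH] j /=.
  under eq_fun do rewrite fser_truncate//; exact: fserP.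
apply: (@squeeze0 R _ (fun K =>
  modulus (level (truncate K a) n j.+1 z - level a n j.+1 z) +
  modulus z * modulus (level (truncate K a) n j z - level a n j z))).
  move=> K; rewrite modulus_ge0 /= -(modulus_conj z) -modulusM.
  rewrite (le_trans _ (modulusB _ _))//; apply: le_of_eq; congr modulus; ring.
rewrite -(addr0 (0 : R)); apply: cvgD; first exact: IH.
rewrite -(mulr0 (modulus z)); apply: cvgMl_tmp; exact: IH.
Qed.

(** On polynomials of degree below [K], a derivative costs at most a factor [K] and multiplication
    by [conj z] at most [r]; hence a factor [K + r] for each application of [d_z - conj z]. *)
Lemma level_truncate_le K a n j z (r : R) : entire a -> 1 <= r -> modulus z <= r ->
  modulus (level (truncate K a) n j z) <=
  (\sum_(0 <= k < K) modulus (a k) * r ^+ k) * (K%:R + r) ^+ n * K%:R ^+ j.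
Proof.
move=> ea r1 zr; have r0 : 0 <= r by rewrite (le_trans ler01).
set M := \sum_(_ <= _ < _) _.
have M0 : 0 <= M.
  by apply: sumr_ge0 => k _; rewrite mulr_ge0 ?modulus_ge0 ?exprn_ge0.
elim: n j => [|n IH] j /=.
  rewrite fser_truncate// mulr1 /series/= /M mulr_suml.
  have : modulus (\sum_(0 <= k < K) pow_deriv a j z k) <=
      \sum_(0 <= k < K) modulus (pow_deriv a j z k).
    elim: (K) => [|m IH]; first by rewrite !big_geq// modulus0.
    by rewrite !big_nat_recr//= (le_trans (modulusD _ _))// lerD2r.
  move/le_trans; apply; rewrite !big_nat; apply: ler_sum => k /andP[_ kK].
  rewrite /pow_deriv !modulusM modulus_nat modulusX mulrAC ler_pM ?mulr_ge0//
    ?exprn_ge0 ?modulus_ge0//.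
    rewrite ler_wpM2l ?modulus_ge0// (le_trans (lerXn2r _ _ _ zr)) ?nnegrE ?modulus_ge0//.
    by rewrite ler_weXn2l// leq_subr.
  rewrite -natrX ler_nat; elim: j => // j IH.
  rewrite ffactnSr expnSr leq_mul// (leq_trans (leq_subr _ _))//.
  exact: ltnW.
apply: (le_trans (modulusB _ _)); rewrite modulusM modulus_conj.
apply: (@le_trans _ _ (M * (K%:R + r) ^+ n * K%:R ^+ j.+1 +
    r * (M * (K%:R + r) ^+ n * K%:R ^+ j))).
  by rewrite lerD// ler_pM ?modulus_ge0.
by apply: le_of_eq; rewrite !exprSr; ring.
Qed.

Lemma exprn_fact_bounded (x : R) : exists M, forall n, x ^+ n / n`!%:R <= M.
Proof.
have /cvgP/cvg_seq_bounded/bounded_fun_has_ubound[M HM] := cvg_exp_coeff x.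
by exists M => n; apply: HM; exists n.
Qed.

Lemma intensity_truncate_bounded K a (r : R) : entire a -> 1 <= r ->
  exists C, forall n z, modulus z <= r -> intensity (truncate K a) n z <= C.
Proof.
move=> ea r1; have r0 : 0 <= r by rewrite (le_trans ler01).
set M := \sum_(0 <= k < K) modulus (a k) * r ^+ k.
have M0 : 0 <= M.
  by apply: sumr_ge0 => k _; rewrite mulr_ge0 ?modulus_ge0 ?exprn_ge0.
have [B HB] := exprn_fact_bounded ((K%:R + r) ^+ 2).
exists (M ^+ 2 * B) => n z zr; rewrite /intensity.
have Kr0 : 0 <= K%:R + r by rewrite addr_ge0.
apply: (@le_trans _ _ (1 * (M * (K%:R + r) ^+ n) ^+ 2 / n`!%:R)).
  rewrite ler_wpM2r ?invr_ge0// ler_pM ?expR_ge0 ?sqr_ge0//.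
    by rewrite -expR0 ler_expR oppr_le0 sqr_ge0.
  rewrite lerXn2r ?nnegrE ?modulus_ge0 ?mulr_ge0 ?exprn_ge0//.
  by have := level_truncate_le K n 0 ea r1 zr; rewrite expr0 mulr1.
rewrite mul1r exprMn -mulrA ler_wpM2l ?sqr_ge0//.
by rewrite exprAC; exact: HB.
Qed.

Lemma mass_truncate_bounded K a (r : R) : entire a -> 1 <= r ->
  exists2 C, 0 <= C & forall N z, modulus z <= r -> mass (truncate K a) N z <= C * N%:R.
Proof.
move=> ea r1; have [C HC] := intensity_truncate_bounded K ea r1.
exists C.
  have z0 : modulus (0 : R[i]) <= r by rewrite modulus0 (le_trans ler01).
  by rewrite (le_trans (intensity_ge0 _ _ _) (HC 0%N 0 z0)).
move=> N z zr; rewrite mulr_natr -[N in _ *+ N]subn0 -sumr_const_nat.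
by apply: ler_sum => n _; exact: HC.
Qed.

(** Squared, the claim reads [64 r^2 * 2 N <= N^2], which is the origin of 128. The factor 8 is what
    makes the variation over a window of length [N] at most half of the assumed bound. *)
Lemma sqrt_addnn_le (r : R) (N : nat) : 1 <= r -> 128 * r ^+ 2 <= N%:R ->
  8 * r * Num.sqrt (N + N)%:R <= N%:R.
Proof.
move=> r1 rN; have r0 : 0 <= r by rewrite (le_trans ler01).
rewrite -(@ler_sqr R) ?nnegrE ?mulr_ge0 ?sqrtr_ge0//.
rewrite exprMn sqr_sqrtr// natrD.
rewrite [leLHS](_ : _ = (128 * r ^+ 2) * N%:R); last by ring.
by rewrite expr2 ler_wpM2r.
Qed.

(* A bound [(4 C0 + q) N] at [2 N] improves to [(4 C0 + q / 2) N] at [N]; hence the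
   final bound does not depend on [C], and truncated series can be used. *)
Lemma mass_linear_of_bounded a (C0 C r : R) : entire a -> 1 <= r -> 0 <= C ->
  (forall N, mass a N 0 <= C0 * N%:R) ->
  (forall N z, modulus z <= r -> mass a N z <= C * N%:R) ->
  forall N z, (0 < N)%N -> 128 * r ^+ 2 <= N%:R -> modulus z <= r ->
    mass a N z <= 4 * C0 * N%:R.
Proof.
move=> ea r1 C_ge0 H0 HC.
have r0 : 0 <= r by rewrite (le_trans ler01).
have C00 : 0 <= C0 by have := H0 1%N; rewrite mulr1; apply: le_trans; exact: mass_ge0.
have step j : forall N z, (0 < N)%N -> 128 * r ^+ 2 <= N%:R -> modulus z <= r ->
    mass a N z <= (4 * C0 + C * 2^-1 ^+ j) * N%:R.
  elim: j => [|j IH] N z N0 rN zr.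
    rewrite expr0 mulr1 (le_trans (HC _ _ zr))// ler_wpM2r// lerDr mulr_ge0//.
  set q := 4 * C0 + C * 2^-1 ^+ j in IH.
  have q0 : 0 <= q by rewrite addr_ge0 ?mulr_ge0 ?exprn_ge0// invr_ge0.
  have N2 : (0 < N + N)%N by rewrite addn_gt0 N0.
  have HQ t : 0 <= t <= 1 -> mass a (N + N) (t%:C * z) <= q * (N + N)%:R.
    move=> /andP[t0 t1]; apply: IH => //.
      by rewrite (le_trans rN)// ler_nat leq_addr.
    by rewrite modulusM modulus_real ger0_norm// (le_trans _ zr)// ler_piMl ?modulus_ge0.
  have := mass_avg_variation ea N0 N0 HQ; rewrite ler_norml => /andP[_].
  have /andP[_ A0] := mass_avg_bounds a N 0 N0.
  have /andP[Az _] := mass_avg_bounds a N z N0.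
  rewrite lerBlDr => h; rewrite (le_trans Az)// (le_trans h)//.
  have N_gt0 : 0 < N%:R :> R by rewrite ltr0n.
  have h2 : 2 * modulus z * Num.sqrt (N + N)%:R * (q * (N + N)%:R) / N%:R <=
      2^-1 * q * N%:R.
    rewrite natrD [leLHS](_ : _ = 4 * modulus z * Num.sqrt (N%:R + N%:R) * q); last first.
      by field; rewrite gt_eqF.
    have := sqrt_addnn_le r1 rN; rewrite natrD; set s := Num.sqrt _ => hs.
    have s0 : 0 <= s by rewrite sqrtr_ge0.
    apply: (@le_trans _ _ (2^-1 * q * (8 * r * s))).
      rewrite [leLHS](_ : _ = 2^-1 * q * (8 * modulus z * s)); last by field.
      by rewrite ler_wpM2l ?mulr_ge0 ?invr_ge0// ler_wpM2r// ler_wpM2l.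
    by rewrite ler_wpM2l// mulr_ge0 ?invr_ge0.
  (* The origin contributes [2 C0 N] and the variation half of the previous bound. The constant
     [4 C0] is the fixed point of [x |-> 2 C0 + x / 2], so only the excess over it is halved. *)
  rewrite (le_trans (lerD h2 (le_trans A0 (H0 _))))// natrD.
  by apply: le_of_eq; rewrite /q exprS; field.
move=> N z N0 rN zr.
have lim_step : (4 * C0 + C * 2^-1 ^+ j) * N%:R @[j --> \oo] -->
    (4 * C0 + C * 0) * N%:R.
  apply: cvgMr_tmp; apply: cvgD; first exact: cvg_cst.
  apply: cvgMl_tmp; apply: cvg_expr.
  by rewrite ger0_norm ?invr_ge0// invf_lt1// ltr1n.
rewrite mulr0 addr0 in lim_step.
by apply: (cvgr_to_ge lim_step); apply: nearW => j; exact: step.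
Qed.

Lemma cvg_mass_truncate a N z : entire a ->
  mass (truncate K a) N z @[K --> \oo] --> mass a N z.
Proof.
move=> ea; rewrite /mass; elim: N => [|N IH].
  under eq_fun do rewrite big_geq//.
  by rewrite big_geq//; exact: cvg_cst.
under eq_fun do rewrite big_nat_recr//=.
rewrite big_nat_recr//=; apply: cvgD; first exact: IH.
rewrite /intensity; apply: cvgMr_tmp; apply: cvgMl_tmp.
under eq_fun do rewrite expr2; rewrite expr2.
suff h : modulus (level (truncate K a) N 0 z) @[K --> \oo] --> modulus (level a N 0 z).
  exact: cvgM.
apply/cvgrPdist_le => e e0.
have /cvgrPdist_le/(_ e e0) := cvg_level_truncate N 0 z ea.
apply: filterS => K; rewrite sub0r normrN ger0_norm ?modulus_ge0// => hK.
by rewrite distrC (le_trans (ler_dist_modulus _ _)).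
Qed.

Lemma mass_linear a (C0 r : R) : entire a -> 1 <= r ->
  (forall N, mass a N 0 <= C0 * N%:R) ->
  forall N z, (0 < N)%N -> 128 * r ^+ 2 <= N%:R -> modulus z <= r ->
    mass a N z <= 4 * C0 * N%:R.
Proof.
move=> ea r1 H0 N z N0 rN zr.
apply: (cvgr_to_le (@cvg_mass_truncate a N z ea)); apply: nearW => K.
have [C C_ge0 HC] := mass_truncate_bounded K ea r1.
(* The constant [C] of the truncated series depends on [K] but is absent from the conclusion. It
   remains to see that truncation does not increase the mass at the origin, so that [C0] serves
   every [K]. *)
apply: (mass_linear_of_bounded (entire_truncate K ea) r1 C_ge0 _ HC N0 rN zr) => M.
apply: le_trans (H0 M); apply: ler_sum => n _.
rewrite /intensity !level_at0//; last exact: entire_truncate.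
rewrite ler_wpM2r ?invr_ge0// ler_wpM2l ?expR_ge0//.
rewrite lerXn2r ?nnegrE ?modulus_ge0// !modulusM ler_wpM2l ?modulus_ge0//.
by rewrite /truncate; case: ifP => // _; rewrite modulus0 modulus_ge0.
Qed.

(** Rounding down in [N / m] loses at most half of the quotient, and [L <= N / 2] keeps [N - L]
    beyond both thresholds, so that the window ending at [N] is admissible too. *)
Lemma window_bounds (N1 N2 m N : nat) : (1 < m)%N -> (2 * (N1 + N2 + m) <= N)%N ->
  let L := (N %/ m)%N in
  [/\ (0 < L)%N, (2 * L <= N)%N, (N <= 2 * m * L)%N & (N1 + N2 <= N - L)%N].
Proof.
move=> m1 hN L.
have m0 : (0 < m)%N by apply: ltnW.
have L0 : (0 < L)%N by rewrite divn_gt0//; clear L; lia.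
have LN : (2 * L <= N)%N.
  by rewrite (leq_trans _ (leq_trunc_div N m))// mulnC leq_mul.
have := divn_eq N m; have := ltn_pmod N m0; rewrite -/L => h1 h2.
have Lm : (m <= L * m)%N by rewrite leq_pmull.
by split => //; clearbody L; nia.
Qed.

Lemma mass_uniform a (r : R) : entire a -> 1 <= r ->
  N%:R^-1 * mass a N 0 @[N --> \oo] --> (1 : R) ->
  forall eps : R, 0 < eps -> exists N0, forall N z, (N0 <= N)%N -> modulus z <= r ->
    `|N%:R^-1 * mass a N z - 1| <= eps.
Proof.
move=> ea r1 cvg1 eps eps0.
have r0 : 0 <= r by rewrite (le_trans ler01).
have [C0 HC0] : exists C0, forall N, mass a N 0 <= C0 * N%:R.
  have /cvgP/cvg_seq_bounded/bounded_fun_has_ubound[M HM] := cvg1.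
  exists M => -[|N]; first by rewrite /mass big_geq// mulr0.
  by rewrite -ler_pdivrMr// mulrC; apply: HM; exists N.+1.
have C00 : 0 <= C0 by have := HC0 1%N; rewrite mulr1; apply: le_trans; exact: mass_ge0.
have lin := mass_linear ea r1 HC0.
pose D := 4 * C0; have D0 : 0 <= D by rewrite mulr_ge0.
(* Three errors of size [eta] occur: convergence at the origin, window length and variation. The cap
   at 1 lets the product [eta^2] count as a fourth. *)
pose eta := Num.min (eps / 4) 1.
have eta0 : 0 < eta by rewrite lt_min divr_gt0//=.
have eta1 : eta <= 1 by rewrite ge_min lexx orbT.
have eta4 : 4 * eta <= eps by rewrite -ler_pdivlMl// mulrC ge_min lexx.
have [m m0 meta] : exists2 m : nat, (1 < m)%N & m%:R^-1 <= eta.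
  exists (Num.truncn eta^-1).+2 => //.
  rewrite invf_ple ?posrE//; apply/ltW/(lt_le_trans (truncnS_gt _)).
  by rewrite ler_nat.
have [N1 _ HN1] : \forall N \near \oo, `|1 - N%:R^-1 * mass a N 0| <= eta.
  by move/cvgrPdist_le : cvg1; apply.
(* The first summand forces [sqrt N >= 32 r D m / eta], which makes the variation, at most
   [16 r D m sqrt N], smaller than [eta N]. The second is the threshold of [mass_linear]. *)
pose B := (32 * r * D * m%:R / eta) ^+ 2 + 128 * r ^+ 2.
pose N2 := (Num.truncn B).+1.
exists (2 * (N1 + N2 + m))%N => N z hN zr.
have [] := window_bounds m0 hN; set L := (N %/ m)%N => L0 LN LmN N12.
have PL : (N - L + L = N)%N by rewrite subnK// (leq_trans _ LN)// leq_pmull.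
have P0 : (0 < N - L)%N.
  by rewrite subn_gt0 (leq_trans _ LN)// mul2n -addnn -{1}(addn0 L) ltn_add2l.
have N_gt0 : (0 < N)%N by rewrite (leq_trans P0)// leq_subr.
have NR0 : 0 < N%:R :> R by rewrite ltr0n.
have N1P : (N1 <= N - L)%N by rewrite (leq_trans _ N12)// leq_addr.
have N2P : (N2 <= N - L)%N by rewrite (leq_trans _ N12)// leq_addl.
have N1N : (N1 <= N)%N by rewrite (leq_trans N1P)// leq_subr.
have N2N : (N2 <= N)%N by rewrite (leq_trans N2P)// leq_subr.
have hB M : (N2 <= M)%N -> B <= M%:R.
  by move=> h; rewrite (le_trans (ltW (truncnS_gt _)))// ler_nat.
have hLN : L%:R <= eta * N%:R.
  apply: (@le_trans _ _ (m%:R^-1 * N%:R)); last by rewrite ler_wpM2r.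
  by rewrite ler_pdivlMl ?ltr0n 1?ltnW// -natrM ler_nat mulnC leq_trunc_div.
have LR0 : 0 < L%:R :> R by rewrite ltr0n.
have NmL : N%:R <= 2 * m%:R * L%:R :> R by rewrite -!natrM ler_nat.
have var P : (0 < P)%N -> (P + L <= 2 * N)%N -> (N2 <= P + L)%N ->
    `|mass_avg a P L z - mass_avg a P L 0| <= eta * N%:R.
  move=> P_gt0 PN2 N2PL.
  have HQ t : 0 <= t <= 1 -> mass a (P + L) (t%:C * z) <= D * (P + L)%:R.
    move=> /andP[t0 t1]; apply: lin.
    - by rewrite addn_gt0 P_gt0.
    - by rewrite (le_trans _ (hB _ N2PL))// lerDr sqr_ge0.
    - by rewrite modulusM modulus_real ger0_norm// (le_trans _ zr)// ler_piMl ?modulus_ge0.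
  apply: (le_trans (mass_avg_variation ea P_gt0 L0 HQ)).
  have PR : (P + L)%:R <= 2 * N%:R :> R by rewrite -natrM ler_nat.
  pose s : R := Num.sqrt N%:R.
  have s0 : 0 <= s by exact: sqrtr_ge0.
  have ss : s * s = N%:R by rewrite -expr2 sqr_sqrtr.
  have sP : Num.sqrt (P + L)%:R <= 2 * s.
    rewrite -(@ler_sqr R) ?nnegrE ?sqrtr_ge0 ?mulr_ge0// exprMn !sqr_sqrtr//.
    by rewrite (le_trans PR)// ler_wpM2r// expr2 -natrM ler_nat.
  have sB : 32 * r * D * m%:R / eta <= s.
    rewrite -(@ler_sqr R) ?nnegrE ?divr_ge0 ?mulr_ge0 ?(ltW eta0)//.
    rewrite sqr_sqrtr// (le_trans _ (hB N N2N))//.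
    by rewrite lerDl mulr_ge0// sqr_ge0.
  rewrite ler_pdivrMr// in sB.
  apply: (@le_trans _ _ (2 * r * (2 * s) * (D * (2 * N%:R)) / L%:R)).
    rewrite ler_wpM2r ?invr_ge0// ler_pM ?mulr_ge0 ?sqrtr_ge0 ?modulus_ge0//.
      by rewrite ler_pM ?mulr_ge0 ?sqrtr_ge0 ?modulus_ge0// ler_wpM2l.
    by rewrite ler_wpM2l.
  rewrite ler_pdivrMr//.
  apply: (@le_trans _ _ (2 * r * (2 * s) * (D * (2 * (2 * m%:R * L%:R))))).
    by rewrite ler_wpM2l ?mulr_ge0// ler_wpM2l// ler_wpM2l.
  rewrite [leLHS](_ : _ = 2^-1 * (32 * r * D * m%:R) * s * L%:R); last by field.
  rewrite -ss ler_wpM2r// [leRHS]mulrA ler_wpM2r// (mulrC eta).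
  rewrite (le_trans _ sB)// ler_piMl ?mulr_ge0//.
  by rewrite invf_le1// ler1n.
have at0 P : (N1 <= P)%N -> (0 < P)%N ->
    (1 - eta) * P%:R <= mass a P 0 <= (1 + eta) * P%:R.
  move=> hP P_gt0; have PR0 : 0 < P%:R :> R by rewrite ltr0n.
  have := HN1 P hP; rewrite ler_norml => /andP[h1 h2].
  rewrite -(ler_pdivlMr _ _ PR0) -(ler_pdivrMr _ _ PR0) mulrC.
  clear -h1 h2; lra.
rewrite (le_trans _ eta4)// ler_norml lerBrDr lerBlDr.
rewrite ler_pdivlMl// ler_pdivrMl// mulrC [X in _ && (_ <= X)]mulrC.
apply/andP; split.
(* Lower bound: the window ending at [N], whose average at [z] is below the mass at [N] and whose
   average at 0 is above the mass at [N - L]. *)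
- have /andP[_ zle] := mass_avg_bounds a (N - L) z L0.
  have /andP[le0 _] := mass_avg_bounds a (N - L) 0 L0.
  have := var (N - L)%N P0; rewrite PL => /(_ (leq_pmull N (isT : (0 < 2)%N)) N2N).
  rewrite ler_norml => /andP[h _]; rewrite PL in zle.
  have /andP[h0 _] := at0 (N - L)%N N1P P0.
  rewrite natrB in h0; last by rewrite (leq_trans _ LN)// leq_pmull.
  have e1 : (1 - eta) * (N%:R - L%:R) >= (1 - eta) * (N%:R - eta * N%:R).
    by rewrite ler_wpM2l ?subr_ge0// lerD2l lerN2.
  have e2 : 0 <= eta * eta * N%:R by rewrite !mulr_ge0// ltW.
  have e3 : 0 <= eta * N%:R by rewrite !mulr_ge0// ltW.
  clear -zle le0 h h0 e1 e2 e3; lra.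
(* Upper bound: symmetrically, the window starting at [N], compared at 0 with the mass at
   [N + L]. *)
- have /andP[zle _] := mass_avg_bounds a N z L0.
  have /andP[_ le0] := mass_avg_bounds a N 0 L0.
  have NLN : (N + L <= 2 * N)%N by rewrite mul2n -addnn leq_add2l (leq_trans _ LN)// leq_pmull.
  have := var N N_gt0 NLN (leq_trans N2N (leq_addr _ _)).
  rewrite ler_norml => /andP[_ h].
  have /andP[_ h0] := at0 (N + L)%N (leq_trans N1N (leq_addr _ _)) (leq_trans N_gt0 (leq_addr _ _)).
  rewrite natrD in h0.
  have e1 : (1 + eta) * (N%:R + L%:R) <= (1 + eta) * (N%:R + eta * N%:R).
    by rewrite ler_wpM2l ?addr_ge0 ?(ltW eta0)// lerD2l.
  have e2 : eta * (eta * N%:R) <= 1 * (eta * N%:R).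
    by rewrite ler_wpM2r// mulr_ge0// ltW.
  have e3 : 0 <= eta * N%:R by rewrite !mulr_ge0// ltW.
  clear -zle le0 h h0 e1 e2 e3; lra.
Qed.

End linear_growth.

(** * Continuity of the masses, and convergence in the sup norm *)

Section continuity.
Context {R : realType}.
Implicit Types z : R[i].

Lemma modulus_continuousP (f : R[i]^o -> R) (z : R[i]^o) :
  (forall e, 0 < e -> exists2 d, 0 < d &
    forall h, modulus h < d -> `|f (z + h) - f z| <= e) ->
  {for z, continuous f}.
Proof.
move=> H; have FF := @nbhs_filter (R[i]^o) z.
apply: (proj2 (@cvgrPdist_le _ _ _ (nbhs z) FF f (f z))) => e e0.
have [d d0 hd] := H e e0.
have dC : 0 < d%:C by rewrite ltcR.
near=> y.
have : `|(z : R[i]^o) - y| < d%:C by near: y; exact: cvgr_dist_lt.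
rewrite distrC normC_modulus ltcR => /hd.
  rewrite (_ : (z : R[i]) + _ = y); first by rewrite distrC.
  by rewrite addrC subrK.
Unshelve. all: by end_near. Qed.

Lemma continuous_modulus : continuous (modulus : R[i]^o -> R).
Proof.
move=> z; apply: modulus_continuousP => e e0; exists e => // h /ltW he.
by rewrite (le_trans (ler_dist_modulus _ _))// addrAC subrr add0r.
Qed.

(** For [|h| < 1] the quadratic remainder is at most linear, so increments at [z] are bounded by a
    constant times [|h|]. *)
Lemma has_wirtinger_continuous (g : R[i] -> R[i]) (z : R[i]^o) a b : has_wirtinger g z a b ->
  {for z, continuous ((fun w => modulus (g w)) : R[i]^o -> R)}.
Proof.
move=> [C [d [d0 H]]]; apply: modulus_continuousP => e e0.
set A := modulus a + modulus b + `|C| + 1.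
have A0 : 0 < A by rewrite ltr_wpDl// !addr_ge0 ?modulus_ge0.
exists (Num.min (Num.min d 1) (e / A)).
  by rewrite !lt_min d0 ltr01 divr_gt0.
move=> h; rewrite !lt_min => /andP[/andP[hd h1] he].
rewrite (le_trans (ler_dist_modulus _ _))//.
have := H h (ltW hd); set x := _ - _ => hx.
have -> : g (z + h) - g z = x + (a * h + b * conjc h) by rewrite /x subrK.
rewrite (le_trans (modulusD _ _))//.
have m0 : 0 <= modulus h by exact: modulus_ge0.
apply: (@le_trans _ _ (A * modulus h)); last by rewrite mulrC -ler_pdivlMr// ltW.
have x1 : modulus x <= `|C| * modulus h.
  rewrite (le_trans hx)// expr2 mulrA ler_wpM2r//.
  rewrite (le_trans (ler_norm _))// normrM (ger0_norm m0).
  by rewrite ler_piMr ?(ltW h1).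
have x2 : modulus (a * h + b * conjc h) <= (modulus a + modulus b) * modulus h.
  by rewrite (le_trans (modulusD _ _))// !modulusM modulus_conj mulrDl.
by rewrite (le_trans (lerD x1 x2))// -mulrDl ler_wpM2r// /A addrC lerDl.
Qed.

Lemma continuous_expMsqr (T : topologicalType) (f g : T -> R) (x : R) :
  continuous f -> continuous g ->
  continuous (fun t => expR (- f t ^+ 2) * g t ^+ 2 / x).
Proof.
move=> cf cg.
have sq (h : T -> R) : continuous h -> continuous (fun t => h t ^+ 2).
  move=> ch t; apply: (@continuous_comp _ _ _ h (fun x => x ^+ 2)); first exact: ch.
  exact: exprn_continuous.
move=> t; apply: cvgMr_tmp; apply: cvgM; last exact: sq.
apply: (@continuous_comp _ _ _ (fun t => - f t ^+ 2) expR); last exact: continuous_expR.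
by apply: cvgN; exact: sq.
Qed.

Lemma continuous_sum (T : topologicalType) (f : nat -> T -> R) (N : nat) :
  (forall n, continuous (f n)) -> continuous (fun t => \sum_(0 <= n < N) f n t).
Proof.
move=> cf; elim: N => [|N IH].
  rewrite (_ : (fun _ => _) = cst 0); first exact: cst_continuous.
  by apply/funext => t; rewrite big_geq.
rewrite (_ : (fun _ => _) = (fun t => \sum_(0 <= n < N) f n t + f N t)).
  by move=> t; apply: cvgD; [exact: IH|exact: cf].
by apply/funext => t; rewrite big_nat_recr.
Qed.

Lemma continuous_mull (T : topologicalType) (f : T -> R) (x : R) :
  continuous f -> continuous (fun t => x * f t).
Proof. by move=> cf t; apply: cvgMl_tmp; exact: cf. Qed.

Lemma continuous_intensity (a : nat -> R[i]) n : entire a ->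
  continuous (intensity a n : R[i]^o -> R).
Proof.
move=> ea; apply: continuous_expMsqr => //; first exact: continuous_modulus.
by move=> z; exact: has_wirtinger_continuous (has_wirtinger_level n 0 z ea).
Qed.

Lemma continuous_mass (a : nat -> R[i]) N : entire a ->
  continuous (mass a N : R[i]^o -> R).
Proof.
by move=> ea; apply: continuous_sum => n; exact: continuous_intensity.
Qed.

Lemma compact_modulus_bounded (K : set R[i]^o) : compact K ->
  exists2 r : R, 1 <= r & forall z, K z -> modulus z <= r.
Proof.
move=> cK.
have := @continuous_compact _ _ (modulus : R[i]^o -> R) K
  (continuous_subspaceT continuous_modulus) cK.
move=> /compact_bounded[M [Mr HM]].
exists (Num.max 1 (M + 1)); first by rewrite le_max lexx.
move=> z Kz; rewrite le_max; apply/orP; right.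
have := HM (M + 1) _ (modulus z); rewrite ltrDl ltr01 => /(_ isT).
by rewrite /= ger0_norm ?modulus_ge0//; apply; exists z.
Qed.

Lemma cvg_sup_norm (K : set R[i]) (g : nat -> R[i] -> R) :
  (forall eps : R, 0 < eps -> exists N0, forall N z, (N0 <= N)%N -> K z ->
    `|g N z| <= eps) ->
  sup_norm K (g N) @[N --> \oo] --> 0%E.
Proof.
move=> H.
have bnd eps : 0 < eps -> \forall N \near \oo, (0 <= sup_norm K (g N) <= eps%:E)%E.
  move=> eps0; have [N0 HN] := H eps eps0.
  near=> N; rewrite /sup_norm le_max lexx /= ge_max lee_fin (ltW eps0) /=.
  apply: ge_ereal_sup => _ [z Kz <-]; rewrite lee_fin; apply: HN => //.
  by near: N; exact: nbhs_infty_ge.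
apply/fine_cvgP; split.
  near=> N; have /andP[h1 h2] : (0 <= sup_norm K (g N) <= 1%:E)%E.
    by near: N; exact: bnd.
  by rewrite ge0_fin_numE// (le_lt_trans h2)// ltry.
apply/cvgrPdist_le => e e0; near=> N.
have /andP[h1 h2] : (0 <= sup_norm K (g N) <= e%:E)%E by near: N; exact: bnd.
rewrite sub0r normrN ger0_norm ?fine_ge0//=.
by rewrite -lee_fin fineK// ge0_fin_numE// (le_lt_trans h2)// ltry.
Unshelve. all: by end_near. Qed.

End continuity.

(** * From convergent means of the squared coefficients to uniform convergence *)

Section realization.
Context {R : realType}.
Variable c : nat -> R[i].
Hypothesis cvg_mean : N%:R^-1 * (\sum_(0 <= n < N) modulus (c n) ^+ 2) @[N --> \oo] --> (1 : R).

Let a (k : nat) : R[i] := c k / (Num.sqrt k`!%:R)%:C.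

(** A convergent sequence of means is bounded, so [|c_k|^2] grows at most linearly and [|c_k|] at
    most like [2 ^ k]; the factor [1 / sqrt(k!)] beats every geometric growth. Convergence of the
    series thus follows from the law of large numbers itself. *)
Lemma entire_coef : entire a.
Proof.
have [M HM] : exists M : R, forall k, modulus (c k) <= M * 2 ^+ k.
  have /cvgP/cvg_seq_bounded/bounded_fun_has_ubound[B HB] := cvg_mean.
  have B0 : 0 <= B.
    have := HB _ (ex_intro2 _ _ 0%N I erefl).
    by rewrite /= big_geq// mulr0.
  exists (B + 1) => k.
  have h : modulus (c k) ^+ 2 <= B * k.+1%:R.
    have /= hk := HB _ (ex_intro2 _ _ k.+1 I erefl).
    rewrite -ler_pdivrMr// mulrC (le_trans _ hk)//.
    rewrite ler_wpM2l ?invr_ge0// big_nat_recr//= lerDr.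
    by apply: sumr_ge0 => i _; exact: sqr_ge0.
  rewrite -(@ler_sqr R) ?nnegrE ?modulus_ge0 ?mulr_ge0 ?addr_ge0 ?exprn_ge0//.
  rewrite (le_trans h)// exprMn ler_pM//.
    by rewrite expr2 -[leLHS]mulr1 ler_pM// ?lerDr ?lerDl.
  rewrite -exprM -natrX ler_nat.
  by rewrite (leq_trans (ltn_expl k (isT : (1 < 2)%N)))// leq_exp2l// leq_pmulr.
(* In [4 * rho] one factor 2 absorbs the growth of the coefficients and the other yields the decay
   [2^-1 ^+ k]. The square matches [k!] in place of its square root. *)
move=> rho rho0; have [B HB] := exprn_fact_bounded ((4 * rho) ^+ 2).
have M0 : 0 <= M.
  by have := HM 0%N; rewrite expr0 mulr1; apply: le_trans; exact: modulus_ge0.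
exists (M * (1 + B)) => k.
rewrite /a modulusM modulusV modulus_real ger0_norm ?sqrtr_ge0//.
set f := k`!%:R; have f0 : 0 < f :> R by rewrite ltr0n fact_gt0.
have sB : (4 * rho) ^+ k / Num.sqrt f <= 1 + B.
  set x := (X in X <= _).
  have x2 : x ^+ 2 <= B.
    have := HB k; congr (_ <= _); rewrite /x expr_div_n sqr_sqrtr ?ltW//.
    by rewrite exprAC.
  have [x1|x1] := leP x 1.
    by rewrite (le_trans x1)// lerDl (le_trans _ x2)// sqr_ge0.
  have x0 : 0 <= x by exact: ltW (lt_trans ltr01 x1).
  have xx : x <= x ^+ 2 by rewrite expr2 ler_peMl// ltW.
  by rewrite (le_trans (le_trans xx x2))// lerDr.
have -> : modulus (c k) / Num.sqrt f * rho ^+ k = modulus (c k) / 4 ^+ k * ((4 * rho) ^+ k / Num.sqrt f).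
  rewrite exprMn; field.
  by rewrite expf_neq0//= gt_eqF// sqrtr_gt0.
have -> : M * (1 + B) * 2^-1 ^+ k = M * 2 ^+ k / 4 ^+ k * (1 + B).
  have -> : (4 : R) = 2 * 2 by ring.
  rewrite exprMn exprVn; field.
  by rewrite expf_neq0.
rewrite ler_pM//.
- by rewrite divr_ge0 ?modulus_ge0 ?exprn_ge0.
- by rewrite divr_ge0 ?sqrtr_ge0// exprn_ge0// mulr_ge0.
- by rewrite ler_wpM2r ?invr_ge0 ?exprn_ge0.
Qed.

Lemma gefE : gef c = fser a 0.
Proof.
apply/funext => z; rewrite /gef /fser /csum; congr (limn (series _ : nat -> R[i]^o)).
by apply/funext => k; rewrite /pow_deriv /a ffactn0 subn0 mulr1 mulrAC.
Qed.

Lemma iter_dz_sub_conj n : iter n dz_sub_conj (gef c) = level a n 0.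
Proof.
elim: n => [|n IH]; first exact: gefE.
rewrite iterS IH; apply/funext => z; rewrite /dz_sub_conj.
by rewrite (has_wirtinger_wirtinger (has_wirtinger_level n 0 z entire_coef)).
Qed.

Lemma S_meanE N z : S_mean c N z = N%:R^-1 * mass a N z.
Proof.
rewrite /S_mean /mass; congr (_ * _); apply: eq_bigr => n _.
rewrite /X_level /gef_level iter_dz_sub_conj /intensity !modulusM !modulus_real.
rewrite !exprMn !real_normK ?num_real// exprVn sqr_sqrtr// mulrA mulrAC.
by congr (_ * _ / _); rewrite expr2 -expRD; congr expR; field.
Qed.

Lemma cvg_mass0 : N%:R^-1 * mass a N 0 @[N --> \oo] --> (1 : R).
Proof.
rewrite (_ : (fun N => _) = fun N : nat => N%:R^-1 * \sum_(0 <= n < N) modulus (c n) ^+ 2) //.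
apply/funext => N; congr (_ * _); apply: eq_bigr => n _.
rewrite /intensity level_at0; last exact: entire_coef.
rewrite modulus0 expr0n /= oppr0 expR0 mul1r addn0 /a !modulusM modulus_nat.
rewrite modulusV modulus_real ger0_norm ?sqrtr_ge0// !exprMn exprVn sqr_sqrtr//.
by field; rewrite pnatr_eq0 -lt0n fact_gt0.
Qed.

Lemma realization_uniform (K : set R[i]^o) : compact K ->
  (forall N, {within K, continuous (S_mean c N : R[i]^o -> R)}) /\
  sup_norm K (fun z => S_mean c N z - 1) @[N --> \oo] --> 0%E.
Proof.
move=> cK; split => [N|].
  apply: continuous_subspaceT.
  rewrite (_ : S_mean c N = fun z => N%:R^-1 * mass a N z); last first.
    by apply/funext => z; exact: S_meanE.
  apply: continuous_mull; exact: continuous_mass entire_coef.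
have [r r1 Kr] := compact_modulus_bounded cK.
apply: cvg_sup_norm => eps eps0.
have [N0 HN] := mass_uniform entire_coef r1 cvg_mass0 eps0.
by exists N0 => N z N0N Kz; rewrite S_meanE; apply: HN => //; exact: Kr.
Qed.

End realization.

(** * Strong law of large numbers *)

Section cesaro_along_squares.
Context {R : realType}.

Lemma nat_sqrt_ex (N : nat) : exists m, (m ^ 2 <= N < (m.+1) ^ 2)%N.
Proof.
elim: N => [|N [m /andP[mN Nm]]]; first by exists 0%N.
have [h|h] := ltnP N.+1 (m.+1 ^ 2).
  by exists m; rewrite h andbT (leq_trans mN).
exists m.+1; rewrite h /= (leq_ltn_trans Nm)//.
by rewrite ltn_exp2r.
Qed.

(** Monotonicity sandwiches [S N] between its values at consecutive squares, whose ratio tends to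
    1. *)
Lemma cesaro_squares (S : nat -> R) : (forall N M, (N <= M)%N -> S N <= S M) ->
  (m.+1 ^ 2)%:R^-1 * S (m.+1 ^ 2)%N @[m --> \oo] --> (1 : R) ->
  N%:R^-1 * S N @[N --> \oo] --> (1 : R).
Proof.
move=> ndS h; apply/cvgrPdist_le => e e0.
pose eta := Num.min (e / 4) 1.
have eta0 : 0 < eta by rewrite lt_min divr_gt0//=.
have eta1 : eta <= 1 by rewrite ge_min lexx orbT.
have eta4 : 4 * eta <= e by rewrite -ler_pdivlMl// mulrC ge_min lexx.
move/cvgrPdist_le: h => /(_ eta eta0)[m0 _ Hm].
have Hs m : (m0 < m)%N -> (1 - eta) * (m ^ 2)%:R <= S (m ^ 2)%N <= (1 + eta) * (m ^ 2)%:R.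
  case: m => // m; rewrite ltnS => mm.
  have p0 : 0 < (m.+1 ^ 2)%:R :> R by rewrite ltr0n expn_gt0.
  have := Hm m mm; rewrite /= ler_norml.
  rewrite -(ler_pdivlMr _ _ p0) -(ler_pdivrMr _ _ p0) [_ / _]mulrC.
  by move: (_^-1 * _) => x /andP[h1 h2]; apply/andP; split; clear -h1 h2; lra.
(* Beyond [3 / eta] the gap satisfies [2 m + 1 <= 3 m <= eta m^2], that is
   [(m + 1)^2 <= (1 + eta) m^2]. *)
pose m1 := (maxn m0 (Num.truncn (3 / eta))).+1.
exists (m1 ^ 2)%N => // N /= hN.
have [m /andP[mN Nm]] := nat_sqrt_ex N.
have m1m : (m1 <= m)%N.
  by rewrite -ltnS -(@ltn_exp2r _ _ 2)// (leq_ltn_trans hN).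
have m0m : (m0 < m)%N by rewrite (leq_trans _ m1m)// ltnS leq_maxl.
have etam : 3 <= eta * m%:R.
  rewrite mulrC -ler_pdivrMr// ltW// (lt_le_trans (truncnS_gt _))// ler_nat.
  by rewrite (leq_trans _ m1m)// ltnS leq_maxr.
have mR : 1 <= m%:R :> R by rewrite ler1n (leq_trans _ m0m).
have N0 : 0 < N%:R :> R by rewrite ltr0n (leq_trans _ mN)// expn_gt0 (leq_trans _ m0m).
have /andP[lo _] := Hs m m0m.
have /andP[_ hi] := Hs m.+1 (ltnW m0m).
have S1 := ndS _ _ mN; have S2 := ndS _ _ (ltnW Nm).
have mNR : m%:R * m%:R <= N%:R :> R by rewrite -natrM ler_nat mulnn.
have NmR : N%:R <= (m%:R + 1) * (m%:R + 1) :> R.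
  by rewrite natr1 -natrM ler_nat mulnn ltnW.
rewrite natrX expr2 in lo; rewrite natrX expr2 -natr1 in hi.
have grow : (m%:R + 1) * (m%:R + 1) <= (1 + eta) * (m%:R * m%:R).
  have -> : (1 + eta) * (m%:R * m%:R) = m%:R * m%:R + eta * m%:R * m%:R by ring.
  have h3 : 3 * m%:R <= eta * m%:R * m%:R by rewrite ler_wpM2r.
  have : (m%:R + 1) * (m%:R + 1) = m%:R * m%:R + 2 * m%:R + 1 :> R by ring.
  by move: h3 mR => + + ->; lra.
rewrite (le_trans _ eta4)// ler_norml.
have up : S N <= (1 + 4 * eta) * N%:R.
  have h1 : (1 + eta) * ((m%:R + 1) * (m%:R + 1)) <= (1 + eta) * ((1 + eta) * N%:R).
    rewrite ler_wpM2l ?addr_ge0 ?(ltW eta0)// (le_trans grow)//.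
    by rewrite ler_wpM2l ?addr_ge0 ?(ltW eta0).
  have h2 : eta * (eta * N%:R) <= 1 * (eta * N%:R).
    by rewrite ler_wpM2r// mulr_ge0 ?ltW.
  have h3 : 0 <= eta * N%:R by rewrite mulr_ge0// ltW.
  clear -h1 h2 h3 hi S2; lra.
have dn : (1 - 4 * eta) * N%:R <= S N.
  have h1 : (1 - eta) * N%:R <= (1 - eta) * (m%:R * m%:R + eta * N%:R).
    rewrite ler_wpM2l ?subr_ge0// (le_trans (le_trans NmR grow))//.
    rewrite mulrDl mul1r lerD2l ler_wpM2l// ltW//.
  have h2 : 0 <= eta * (eta * N%:R) by rewrite !mulr_ge0// ltW.
  have h3 : 0 <= eta * N%:R by rewrite mulr_ge0// ltW.
  clear -h1 h2 h3 lo S1; lra.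
have -> : 1 - N%:R^-1 * S N = (N%:R - S N) / N%:R by field; rewrite gt_eqF.
rewrite ler_pdivlMr// ler_pdivrMr//; apply/andP; split; clear -up dn; lra.
Qed.

End cesaro_along_squares.

(** * The strong law from second moments *)

Section strong_law.
Context d (T : measurableType d) (R : realType) (P : probability T R).
Variables (U : nat -> T -> R) (C : R).
Hypothesis mU : forall n, measurable_fun setT (U n).
Hypothesis U0 : forall n w, 0 <= U n w.
Hypothesis EU : forall n, (\int[P]_w (U n w)%:E = 1)%E.
Hypothesis EU2 : forall n, (\int[P]_w (U n w ^+ 2)%:E <= C%:E)%E.
Hypothesis EUU : forall i j, i != j -> (\int[P]_w (U i w * U j w)%:E = 1)%E.

Let S (N : nat) (w : T) : R := \sum_(0 <= n < N) U n w.

Let mS N : measurable_fun setT (S N).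
Proof. by apply: measurable_sum. Qed.

Let S0 N w : 0 <= S N w.
Proof. by apply: sumr_ge0. Qed.

Let SS N w : S N.+1 w = S N w + U N w.
Proof. by rewrite /S big_nat_recr. Qed.

Lemma C_ge0 : 0 <= C.
Proof.
rewrite -lee_fin (le_trans _ (EU2 0))// integral_ge0// => w _.
by rewrite lee_fin sqr_ge0.
Qed.

Lemma integral_S N : (\int[P]_w (S N w)%:E = N%:R%:E)%E.
Proof.
elim: N => [|N IH].
  by apply: integral0_eq => w _; rewrite /S big_geq.
under eq_integral do rewrite SS EFinD.
rewrite ge0_integralD//; last 4 first.
- by move=> w _; rewrite lee_fin.
- exact/measurable_EFinP.
- by move=> w _; rewrite lee_fin.
- exact/measurable_EFinP.
by rewrite IH EU -natr1.
Qed.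

Lemma integral_SU N M : (N <= M)%N -> (\int[P]_w (S N w * U M w)%:E = N%:R%:E)%E.
Proof.
elim: N => [|N IH] NM.
  by apply: integral0_eq => w _; rewrite /S big_geq// mul0r.
under eq_integral do rewrite SS mulrDl EFinD.
rewrite ge0_integralD//; last 4 first.
- by move=> w _; rewrite lee_fin mulr_ge0.
- by apply/measurable_EFinP; exact: measurable_funM.
- by move=> w _; rewrite lee_fin mulr_ge0.
- by apply/measurable_EFinP; exact: measurable_funM.
by rewrite IH ?(ltnW NM)// EUU ?ltn_eqF// -natr1.
Qed.

Lemma integral_S2 N : (\int[P]_w (S N w ^+ 2)%:E <= (N%:R * C + N%:R ^+ 2)%:E)%E.
Proof.
elim: N => [|N IH].
  rewrite integral0_eq ?mul0r ?expr0n ?addr0// => w _.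
  by rewrite /S big_geq// expr0n.
have E w : S N.+1 w ^+ 2 = S N w ^+ 2 + (2 * (S N w * U N w) + U N w ^+ 2).
  by rewrite SS; ring.
under eq_integral do rewrite E EFinD EFinD (EFinM 2).
have mS2 : measurable_fun setT (fun w => (S N w ^+ 2)%:E).
  by apply/measurable_EFinP; exact: measurable_funX.
have mSU : measurable_fun setT (fun w => (S N w * U N w)%:E).
  by apply/measurable_EFinP; exact: measurable_funM.
have mU2 : measurable_fun setT (fun w => (U N w ^+ 2)%:E).
  by apply/measurable_EFinP; exact: measurable_funX.
have SU_ge0 w : (0 <= (S N w * U N w)%:E)%E by rewrite lee_fin mulr_ge0.
rewrite ge0_integralD//; last 3 first.
- by move=> w _; rewrite lee_fin sqr_ge0.
- by move=> w _; rewrite adde_ge0 ?mule_ge0// lee_fin ?sqr_ge0.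
- by apply: emeasurable_funD => //; exact: measurable_funeM.
rewrite ge0_integralD//; last 3 first.
- by move=> w _; rewrite mule_ge0.
- exact: measurable_funeM.
- by move=> w _; rewrite lee_fin sqr_ge0.
rewrite ge0_integralZl_EFin// integral_SU//.
rewrite (le_trans (leeD IH (leeD (lexx _) (EU2 N))))//.
by rewrite -EFinM -!EFinD lee_fin -natr1; lra.
Qed.

(* [(S - N)^2 + 2 N S = S^2 + N^2] keeps all integrands nonnegative. *)
Lemma integral_dev N : (\int[P]_w ((S N w - N%:R) ^+ 2)%:E <= (N%:R * C)%:E)%E.
Proof.
have mS2 : measurable_fun setT (fun w => (S N w ^+ 2)%:E).
  by apply/measurable_EFinP; exact: measurable_funX.
have mD2 : measurable_fun setT (fun w => ((S N w - N%:R) ^+ 2)%:E).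
  by apply/measurable_EFinP; apply: measurable_funX; exact: measurable_funB.
have mSE : measurable_fun setT (fun w => (S N w)%:E) by exact/measurable_EFinP.
have E : (\int[P]_w ((S N w - N%:R) ^+ 2)%:E + (2 * N%:R * N%:R)%:E =
    \int[P]_w (S N w ^+ 2)%:E + (N%:R ^+ 2)%:E)%E.
  transitivity (\int[P]_w (((S N w - N%:R) ^+ 2)%:E + (2 * N%:R)%:E * (S N w)%:E))%E.
    rewrite ge0_integralD//.
    - by rewrite ge0_integralZl_EFin ?integral_S// => w _; rewrite lee_fin.
    - by move=> w _; rewrite lee_fin sqr_ge0.
    - by move=> w _; rewrite mule_ge0// lee_fin.
    - exact: measurable_funeM.
  transitivity (\int[P]_w ((S N w ^+ 2)%:E + (N%:R ^+ 2)%:E))%E.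
    apply: eq_integral => w _; rewrite -EFinM -!EFinD; congr EFin; ring.
  rewrite ge0_integralD//.
  - by rewrite integral_cst//= probability_setT mule1.
  - by move=> w _; rewrite lee_fin sqr_ge0.
rewrite -(@leeD2rE _ (2 * N%:R * N%:R)%:E)// E.
rewrite (le_trans (leeD (integral_S2 N) (lexx _)))// -!EFinD lee_fin.
by apply/le_of_eq; ring.
Qed.

Lemma sum_inv_sqr_le n : \sum_(0 <= m < n) (m.+1 ^ 2)%:R^-1 <= 2 :> R.
Proof.
(* The sharper bound closes the induction, because [1 / (k+2)^2 <= 1 / (k+1) - 1 / (k+2)]. *)
suff h k : \sum_(0 <= m < k.+1) (m.+1 ^ 2)%:R^-1 <= 2 - k.+1%:R^-1 :> R.
  case: n => [|n]; first by rewrite big_geq.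
  by rewrite (le_trans (h n))// gerBl invr_ge0.
elim: k => [|k IH]; first by rewrite big_nat1 exp1n invr1; lra.
rewrite big_nat_recr//= (le_trans (lerD IH (lexx _)))//.
rewrite natrX -[k.+2%:R]natr1; set x : R := k.+1%:R.
have x0 : 0 < x by rewrite ltr0n.
have x1 : 0 < x + 1 by rewrite addr_gt0.
rewrite -subr_ge0.
have -> : 2 - (x + 1)^-1 - (2 - x^-1 + (x + 1) ^- 2) = (x * (x + 1) ^+ 2)^-1.
  by field; rewrite !gt_eqF.
by rewrite invr_ge0 mulr_ge0 ?exprn_ge0 ?ltW.
Qed.

Let V (m : nat) (w : T) : R := ((m.+1 ^ 2)%:R^-1 * S (m.+1 ^ 2)%N w - 1) ^+ 2.

Let mV m : measurable_fun setT (V m).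
Proof.
apply: measurable_funX; apply: measurable_funB => //.
exact: measurable_funM.
Qed.

Let V0 m w : 0 <= V m w. Proof. exact: sqr_ge0. Qed.

Lemma integral_V m : (\int[P]_w (V m w)%:E <= (C * (m.+1 ^ 2)%:R^-1)%:E)%E.
Proof.
set M := (m.+1 ^ 2)%N.
have M0 : 0 < M%:R :> R by rewrite ltr0n expn_gt0.
have E w : V m w = M%:R ^- 2 * (S M w - M%:R) ^+ 2.
  by rewrite /V -/M; field; rewrite gt_eqF.
under eq_integral do rewrite E EFinM.
rewrite ge0_integralZl_EFin//; last 2 first.
- by move=> w _; rewrite lee_fin sqr_ge0.
- apply/measurable_EFinP; apply: measurable_funX; exact: measurable_funB.
apply: (@le_trans _ _ ((M%:R ^- 2)%:E * (M%:R * C)%:E)%E).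
  by apply: lee_wpmul2l; [rewrite lee_fin invr_ge0 exprn_ge0// ltW|exact: integral_dev].
by rewrite -EFinM lee_fin; apply/le_of_eq; field; rewrite gt_eqF.
Qed.

(** Along squares the expected squared deviations [V m] are at most [C / (m+1)^2], hence summable.
    The random series of the [V m] has finite expectation, so it is almost surely finite and its
    terms tend to 0; [cesaro_squares] fills the gaps because the summands are nonnegative. *)
Lemma strong_law : {ae P, forall w,
  N%:R^-1 * (\sum_(0 <= n < N) U n w) @[N --> \oo] --> (1 : R)}.
Proof.
pose F (w : T) : \bar R := (\sum_(m <oo) (V m w)%:E)%E.
have mVE m : measurable_fun setT (fun w => (V m w)%:E) by exact/measurable_EFinP.
have VE0 m w : (0 <= (V m w)%:E)%E by rewrite lee_fin.
have F0 w : (0 <= F w)%E by apply: nneseries_ge0.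
have iF : (\int[P]_w F w <= (C * 2)%:E)%E.
  rewrite integral_nneseries//; apply: lime_le.
    by apply: is_cvg_nneseries => n _ _; exact: integral_ge0.
  apply: nearW => n.
  rewrite (le_trans (lee_sum _ (fun m _ => integral_V m)))//.
  by rewrite sumEFin lee_fin -mulr_sumr ler_wpM2l ?C_ge0// sum_inv_sqr_le.
have intF : P.-integrable setT F.
  apply/integrableP; split.
    by apply: ge0_emeasurable_sum.
  under eq_integral do rewrite gee0_abs//.
  by rewrite (le_lt_trans iF)// ltry.
have := integrable_ae measurableT intF; apply: filterS => w /(_ I) Ffin.
apply: cesaro_squares => [N M NM|].
  rewrite (big_cat_nat (leq0n N) NM)//= lerDl; exact: sumr_ge0.
have cV : V m w @[m --> \oo] --> (0 : R).
  apply: cvg_series_cvg_0; apply: nondecreasing_is_cvgn.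
    by apply: nondecreasing_series => n _ _.
  exists (fine (F w)) => _ [n _ <-].
  rewrite -lee_fin fineK// /series/= -sumEFin.
  exact: nneseries_lim_ge.
have cVs : `|(m.+1 ^ 2)%:R^-1 * S (m.+1 ^ 2)%N w - 1| @[m --> \oo] --> (0 : R).
  under eq_fun do rewrite -sqrtr_sqr.
  rewrite -(sqrtr0 R); apply: cvg_comp cV _; exact: sqrt_continuous.
apply/cvgrPdist_le => e e0; have /cvgrPdist_le/(_ e e0) := cVs.
by apply: filterS => m; rewrite sub0r normrN normr_id distrC.
Qed.

End strong_law.

(** * Gaussian moments *)

Section density.
Context d (T : measurableType d) (R : realType).
Variables (mu nu : {measure set T -> \bar R}) (p : T -> R).
Hypothesis mp : measurable_fun setT p.
Hypothesis p0 : forall x, 0 <= p x.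
Hypothesis nuE : forall A, measurable A -> nu A = (\int[mu]_(x in A) (p x)%:E)%E.

Import HBNNSimple.

(** The Gaussian law is specified only by its values on measurable sets; simple functions and
    monotone convergence turn this into a formula for expectations. *)
Lemma ge0_integral_density (g : T -> \bar R) : measurable_fun setT g ->
  (forall x, 0 <= g x)%E ->
  (\int[nu]_x g x = \int[mu]_x (g x * (p x)%:E))%E.
Proof.
move=> mg g0; pose h := nnsfun_approx measurableT mg.
have mpE : measurable_fun setT (EFin \o p) by exact/measurable_EFinP.
have hgE x : g x = limn (EFin \o h ^~ x).
  by apply/esym/cvg_lim => //; apply: cvg_nnsfun_approx.
have -> : (\int[nu]_x g x = limn (fun n => \int[nu]_x (EFin \o h n) x))%E.
  under eq_integral do rewrite hgE.
  apply: monotone_convergence => //.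
  - by move=> n; apply/measurable_EFinP.
  - by move=> n x _; rewrite lee_fin.
  - by move=> x _ a b ab; rewrite lee_fin; exact/lefP/nd_nnsfun_approx.
have -> : (\int[mu]_x (g x * (p x)%:E) =
    limn (fun n => \int[mu]_x ((EFin \o h n) x * (p x)%:E)))%E.
  rewrite -monotone_convergence//.
  - apply: eq_integral => x _; apply/esym/cvg_lim => //.
    by apply: cvgeZr => //; apply: cvg_nnsfun_approx.
  - by move=> n; apply: emeasurable_funM => //; apply/measurable_EFinP.
  - by move=> n x _; rewrite mule_ge0// lee_fin.
  - by move=> x _ a b ab; rewrite lee_wpmul2r ?lee_fin//; exact/lefP/nd_nnsfun_approx.
congr (limn _); apply/funext => n.
rewrite integralT_nnsfun sintegralE.
transitivity (\int[mu]_x (\sum_(y \in range (h n))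
    (y * \1_(h n @^-1` [set y]) x)%:E * (p x)%:E))%E; last first.
  apply: eq_integral => x _.
  rewrite -ge0_mule_fsuml => [|y]; last exact: nnfun_muleindic_ge0.
  by rewrite fsumEFin // -(fimfunE _ x).
rewrite ge0_integral_fsum//; last 2 first.
  - move=> y; apply: emeasurable_funM => //; apply/measurable_EFinP.
    exact: measurable_funM.
  - by move=> y x _; rewrite mule_ge0 ?lee_fin//; have := nnfun_muleindic_ge0 (h n) y x.
apply: eq_fsbigr => r rhn.
have r0 : 0 <= r by move: rhn; rewrite inE => -[t _ <-].
under eq_integral do rewrite EFinM -muleA.
rewrite ge0_integralZl//.
- congr (_ * _)%E; rewrite nuE// [LHS]integral_mkcond.
  by apply: eq_integral => x _; rewrite epatch_indic/= muleC.
- by apply: emeasurable_funM => //; apply/measurable_EFinP.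
- by move=> t _; rewrite mule_ge0 ?lee_fin.
Qed.

End density.

(** * Second moment of the one-dimensional Gaussian weight *)

Section gaussian_moments.
Context {R : realType}.
Notation mu := (@lebesgue_measure R).

Let integral_halfline (f F : R -> R) :
  (forall x, 0 <= x -> 0 <= f x) -> continuous f ->
  (forall x : R, is_derive x 1 F (f x)) -> F x @[x --> +oo] --> (0 : R) ->
  (\int[mu]_(x in `[0%R, +oo[) (f x)%:E = (- F 0)%:E)%E.
Proof.
move=> f0 cf dF F0.
have cF : continuous F.
  move=> x; apply: differentiable_continuous; apply/derivable1_diffP.
  exact: (@ex_derive _ _ _ _ _ _ _ (dF x)).
rewrite (@ge0_continuous_FTC2y R f F 0 0)//.
- by rewrite sub0e.
- exact: continuous_subspaceT.
- by apply: cvg_at_right_filter; exact: cF.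
- by move=> x _; rewrite derive1E; exact: (@derive_val _ _ _ _ _ _ _ (dF x)).
Qed.

(** Since [x^2 <= exp(x^2)], the product is at most [1 / x]. *)
Lemma cvg_mulr_gauss_fun : x * gauss_fun x @[x --> +oo] --> (0 : R).
Proof.
apply: (@squeeze_cvgr _ _ _ _ (cst 0) (fun x : R => x^-1)).
- near=> x.
  have x0 : 0 < x by near: x; exact: nbhs_pinfty_gt.
  rewrite /cst mulr_ge0 ?gauss_fun_ge0 ?(ltW x0)//= /gauss_fun expRN.
  rewrite ler_pdivrMr ?expR_gt0// mulrC ler_pdivlMr// -expr2.
  by rewrite (le_trans _ (expR_ge1Dx _))// lerDr.
- exact: cvg_cst.
- apply/(@gtr0_cvgV0 R R (pinfty_nbhs R) _ id); last exact: cvg_id.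
  by near=> x; near: x; exact: nbhs_pinfty_gt.
Unshelve. all: by end_near. Qed.

Lemma integral_sqr_gauss :
  (\int[mu]_x (x ^+ 2 * gauss_fun x)%:E = (Num.sqrt pi / 2)%:E)%E.
Proof.
have cg : continuous (@gauss_fun R) by exact: continuous_gauss_fun.
have csqg : continuous (fun x : R => x ^+ 2 * gauss_fun x).
  by move=> x; apply: cvgM; [exact: exprn_continuous|exact: cg].
have ce : continuous (fun x : R => expR (1 - x)).
  move=> x; apply: (@continuous_comp _ _ _ (fun x : R => 1 - x) expR); last exact: continuous_expR.
  by apply: cvgB; [exact: cvg_cst|exact: cvg_id].
have cve : expR (1 - x) @[x --> +oo] --> (0 : R).
  under eq_fun do rewrite expRD.
  rewrite -(mulr0 (expR 1)); apply: cvgMl_tmp; exact: cvgr_expR.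
have I1 : (\int[mu]_(x in `[0%R, +oo[) (expR (1 - x))%:E = (expR 1)%:E)%E.
  have dF (x : R) : is_derive x 1 (fun x => - expR (1 - x)) (expR (1 - x)).
    have h := is_deriveN (@is_derive1_comp R expR (fun y => 1 - y) x _ _ (is_derive_expR _)
      (is_deriveB (is_derive_cst (1 : R) x 1) (is_derive_id x 1))).
    by apply: is_derive_eq h _; rewrite sub0r mulrN1 opprK.
  rewrite (integral_halfline _ ce dF)//.
  - by rewrite subr0 opprK.
  - by rewrite -oppr0; apply: cvgN.
have csub : continuous (fun x : R => (2 * x ^+ 2 - 1) * gauss_fun x + expR (1 - x)).
  move=> x; apply: cvgD; last exact: ce.
  apply: cvgM; last exact: cg.
  by apply: cvgB; [apply: cvgMl_tmp; exact: exprn_continuous|exact: cvg_cst].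
(* [- x exp(-x^2)] has derivative [(2 x^2 - 1) exp(-x^2)]; adding [exp(1 - x)]
   makes it nonnegative, as the fundamental theorem on a half-line requires. *)
have sub_ge0 (x : R) : 0 <= x -> 0 <= (2 * x ^+ 2 - 1) * gauss_fun x + expR (1 - x).
  move=> x0; have [x1|x1] := leP 1 x.
    rewrite addr_ge0 ?expR_ge0// mulr_ge0 ?gauss_fun_ge0//.
    by have := exprn_ege1 2 x1; lra.
  have h1 : 1 <= expR (1 - x) by rewrite -[leLHS]expR0 ler_expR subr_ge0 ltW.
  have h2 : gauss_fun x <= 1 := gauss_fun_le1 x.
  have h3 : 0 <= x ^+ 2 * gauss_fun x by rewrite mulr_ge0 ?sqr_ge0 ?gauss_fun_ge0.
  by clear -h1 h2 h3; lra.
have I2 : (\int[mu]_(x in `[0%R, +oo[)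
    ((2 * x ^+ 2 - 1) * gauss_fun x + expR (1 - x))%:E = (expR 1)%:E)%E.
  have dF (x : R) : is_derive x 1 (fun x => - (x * gauss_fun x + expR (1 - x)))
      ((2 * x ^+ 2 - 1) * gauss_fun x + expR (1 - x)).
    have hq := is_deriveN (is_deriveX 2 (is_derive_id x (1 : R))).
    have hg := @is_derive1_comp R expR (fun y => - y ^+ 2) x _ _ (is_derive_expR _) hq.
    have he := @is_derive1_comp R expR (fun y => 1 - y) x _ _ (is_derive_expR _)
      (is_deriveB (is_derive_cst (1 : R) x 1) (is_derive_id x 1)).
    have h := is_deriveN (is_deriveD (is_deriveM (is_derive_id x 1) hg) he).
    apply: is_derive_eq h _; rewrite /GRing.scale/= /gauss_fun.
    by ring.
  rewrite (integral_halfline _ csub dF)//.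
  - by rewrite mul0r subr0 add0r opprK.
  - rewrite -oppr0; apply: cvgN; rewrite -(addr0 (0 : R)).
    by apply: cvgD; [exact: cvg_mulr_gauss_fun|].
have m1 : measurable_fun (`[0%R, +oo[%classic : set R) (fun x : R => (x ^+ 2 * gauss_fun x)%:E).
  by apply/measurable_EFinP/measurable_funTS; exact: continuous_measurable_fun.
have m2 : measurable_fun (`[0%R, +oo[%classic : set R)
    (fun x : R => ((2 * x ^+ 2 - 1) * gauss_fun x + expR (1 - x))%:E).
  by apply/measurable_EFinP/measurable_funTS; exact: continuous_measurable_fun.
have m3 : measurable_fun (`[0%R, +oo[%classic : set R) (fun x : R => (gauss_fun x)%:E).
  by apply/measurable_EFinP/measurable_funTS; exact: continuous_measurable_fun.
have m4 : measurable_fun (`[0%R, +oo[%classic : set R) (fun x : R => (expR (1 - x))%:E).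
  by apply/measurable_EFinP/measurable_funTS; exact: continuous_measurable_fun.
rewrite ge0_symfun_integralT//; last 2 first.
- by move=> x; rewrite mulr_ge0 ?sqr_ge0 ?gauss_fun_ge0.
- by move=> x; rewrite /= /gauss_fun sqrrN.
rewrite -set_itvcy.
set J := (\int[mu]_(x in _) _)%E.
have J0 : (0 <= J)%E.
  by apply: integral_ge0 => x _; rewrite lee_fin mulr_ge0 ?sqr_ge0 ?gauss_fun_ge0.
(* The subtraction-free form of integration by parts: both sides integrate the same nonnegative
   function, split in two ways. Finiteness of the left side then excludes an infinite [J]. *)
have E : ((expR 1)%:E + (Num.sqrt pi / 2)%:E = 2%:E * J + (expR 1)%:E)%E.
  transitivity (\int[mu]_(x in `[0%R, +oo[)
      (((2 * x ^+ 2 - 1) * gauss_fun x + expR (1 - x))%:E + (gauss_fun x)%:E))%E.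
    rewrite ge0_integralD// ?I2 ?integral0y_gauss//.
    - by move=> x /=; rewrite in_itv/= andbT => x0; rewrite lee_fin sub_ge0.
    - by move=> x _; rewrite lee_fin gauss_fun_ge0.
  transitivity (\int[mu]_(x in `[0%R, +oo[)
      (2%:E * (x ^+ 2 * gauss_fun x)%:E + (expR (1 - x))%:E))%E; last first.
    rewrite ge0_integralD// ?I1 ?ge0_integralZl_EFin//.
    - by move=> x _; rewrite lee_fin mulr_ge0 ?sqr_ge0 ?gauss_fun_ge0.
    - by move=> x _; rewrite mule_ge0// lee_fin mulr_ge0 ?sqr_ge0 ?gauss_fun_ge0.
    - exact: measurable_funeM.
  apply: eq_integral => x _; rewrite -EFinM -!EFinD; congr EFin; ring.
case: J J0 E => [r r0|_|//].
- rewrite -EFinM -!EFinD => -[E]; congr EFin.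
  by clear -E; lra.
- by rewrite gt0_muley ?lte_fin.
Qed.

End gaussian_moments.

(** * Second and fourth moments of the planar Gaussian density *)

Section planar_gaussian.
Context {R : realType}.
Notation mu := (@lebesgue_measure R).

Definition sqr_dist0 (u : R * R) : R := u.1 ^+ 2 + u.2 ^+ 2.

Lemma sqr_dist0_ge0 u : 0 <= sqr_dist0 u.
Proof. by rewrite addr_ge0 ?sqr_ge0. Qed.

Lemma measurable_sqr_dist0 : measurable_fun setT sqr_dist0.
Proof. by apply: measurable_funD; apply: measurable_funX. Qed.

Lemma std_complex_gaussian_pdf_ge0 (u : R * R) : 0 <= std_complex_gaussian_pdf u.
Proof. by rewrite mulr_ge0 ?invr_ge0 ?pi_ge0 ?expR_ge0. Qed.

Lemma measurable_std_complex_gaussian_pdf :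
  measurable_fun setT (@std_complex_gaussian_pdf R).
Proof.
apply: measurable_funM => //; apply: measurableT_comp => //.
by apply: measurableT_comp => //; exact: measurable_sqr_dist0.
Qed.

Lemma std_complex_gaussian_pdfE (x y : R) :
  std_complex_gaussian_pdf (x, y) = pi^-1 * gauss_fun x * gauss_fun y.
Proof. by rewrite /std_complex_gaussian_pdf/= opprD expRD mulrA. Qed.

Let measurable_gauss : measurable_fun setT (fun x : R => (gauss_fun x)%:E).
Proof. by apply/measurable_EFinP; exact: measurable_gauss_fun. Qed.

Let measurable_sqr_gauss : measurable_fun setT (fun x : R => (x ^+ 2 * gauss_fun x)%:E).
Proof.
apply/measurable_EFinP; apply: measurable_funM; last exact: measurable_gauss_fun.
exact: measurable_funX.
Qed.

(** By Tonelli each coordinate contributes [pi^-1 * sqrt pi * (sqrt pi / 2)], that is 1/2. *)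
Lemma integral_sqr_dist0_pdf :
  (\int[mu \x mu]_u (sqr_dist0 u * std_complex_gaussian_pdf u)%:E = 1)%E.
Proof.
have mf : measurable_fun setT (fun u => (sqr_dist0 u * std_complex_gaussian_pdf u)%:E).
  apply/measurable_EFinP; apply: measurable_funM; first exact: measurable_sqr_dist0.
  exact: measurable_std_complex_gaussian_pdf.
have f0 u : (0 <= (sqr_dist0 u * std_complex_gaussian_pdf u)%:E)%E.
  by rewrite lee_fin mulr_ge0 ?sqr_dist0_ge0 ?std_complex_gaussian_pdf_ge0.
rewrite fubini_tonelli1//.
have g0 (x : R) : (0 <= (gauss_fun x)%:E)%E by rewrite lee_fin gauss_fun_ge0.
have sg0 (x : R) : (0 <= (x ^+ 2 * gauss_fun x)%:E)%E.
  by rewrite lee_fin mulr_ge0 ?sqr_ge0 ?gauss_fun_ge0.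
have c1 (x : R) : 0 <= pi^-1 * gauss_fun x.
  by rewrite mulr_ge0 ?invr_ge0 ?pi_ge0 ?gauss_fun_ge0.
have c2 (x : R) : 0 <= pi^-1 * (x ^+ 2 * gauss_fun x).
  by rewrite mulr_ge0 ?invr_ge0 ?pi_ge0// mulr_ge0 ?sqr_ge0 ?gauss_fun_ge0.
have sp : Num.sqrt pi * Num.sqrt pi = pi :> R by rewrite -expr2 sqr_sqrtr ?pi_ge0.
have pi0 : (pi : R) != 0 by rewrite gt_eqF// pi_gt0.
have inner (x : R) : (\int[mu]_y (sqr_dist0 (x, y) * std_complex_gaussian_pdf (x, y))%:E =
   (pi^-1 * Num.sqrt pi)%:E * (x ^+ 2 * gauss_fun x)%:E +
   (pi^-1 * (Num.sqrt pi / 2))%:E * (gauss_fun x)%:E)%E.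
  transitivity (\int[mu]_y ((pi^-1 * (x ^+ 2 * gauss_fun x))%:E * (gauss_fun y)%:E +
      (pi^-1 * gauss_fun x)%:E * (y ^+ 2 * gauss_fun y)%:E))%E.
    apply: eq_integral => y _; rewrite std_complex_gaussian_pdfE /sqr_dist0/=.
    by rewrite -!EFinM -EFinD; congr EFin; ring.
  rewrite ge0_integralD//; last 4 first.
  - by move=> y _; rewrite mule_ge0// ?sg0 ?g0 ?lee_fin.
  - exact: measurable_funeM.
  - by move=> y _; rewrite mule_ge0// ?sg0 ?g0 ?lee_fin.
  - exact: measurable_funeM.
  rewrite !ge0_integralZl_EFin//.
  rewrite integralT_gauss integral_sqr_gauss -!EFinM -!EFinD.
  congr EFin; ring.
under eq_integral do rewrite /fubini_F inner.
have c3 : 0 <= pi^-1 * Num.sqrt pi :> R by rewrite mulr_ge0 ?invr_ge0 ?pi_ge0.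
have c4 : 0 <= pi^-1 * (Num.sqrt pi / 2) :> R.
  by rewrite mulr_ge0 ?invr_ge0 ?pi_ge0// divr_ge0.
rewrite ge0_integralD//; last 4 first.
- by move=> y _; rewrite mule_ge0// ?sg0 ?g0 ?lee_fin.
- exact: measurable_funeM.
- by move=> y _; rewrite mule_ge0// ?sg0 ?g0 ?lee_fin.
- exact: measurable_funeM.
rewrite !ge0_integralZl_EFin//.
rewrite integralT_gauss integral_sqr_gauss -!EFinM -!EFinD.
congr EFin.
move: sp pi0; move: (Num.sqrt pi) => r; move: (pi : R) => p {c1 c2 c3 c4 inner f0 mf}.
by move=> <- p0; field; move: p0; rewrite mulf_eq0 orbb.
Qed.

(** Only finiteness matters. Half of the exponent absorbs the polynomial, and the other half is, up
    to a constant, a product of two standard normal densities, whose integrals are known. *)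
Lemma integral_sqr_dist0_sqr_pdf : exists C : R,
  (\int[mu \x mu]_u (sqr_dist0 u ^+ 2 * std_complex_gaussian_pdf u)%:E <= C%:E)%E.
Proof.
pose h (x : R) := normal_pdf 0 1 x.
have h0 (x : R) : (0 <= (h x)%:E)%E by rewrite lee_fin normal_pdf_ge0.
have mh : measurable_fun setT (fun x : R => (h x)%:E).
  by apply/measurable_EFinP; exact: measurable_normal_pdf.
have ih : (\int[mu]_x (h x)%:E = 1)%E by exact: integral_normal_pdf.
have hE (x : R) : expR (- (x ^+ 2 / 2)) = (normal_peak 1)^-1 * h x.
  rewrite /h normal_pdfE ?oner_eq0// /normal_fun mulrA mulVf ?mul1r.
    by rewrite subr0 expr1n mulNr.
  by rewrite gt_eqF// normal_peak_gt0.
pose C : R := 16 * pi^-1 * (normal_peak 1)^-1 ^+ 2.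
have C0 : 0 <= C by rewrite !mulr_ge0 ?invr_ge0 ?pi_ge0 ?exprn_ge0 ?invr_ge0 ?normal_peak_ge0.
exists C.
have mf : measurable_fun setT (fun u => (sqr_dist0 u ^+ 2 * std_complex_gaussian_pdf u)%:E).
  apply/measurable_EFinP; apply: measurable_funM.
    by apply: measurable_funX; exact: measurable_sqr_dist0.
  exact: measurable_std_complex_gaussian_pdf.
have f0 u : (0 <= (sqr_dist0 u ^+ 2 * std_complex_gaussian_pdf u)%:E)%E.
  by rewrite lee_fin mulr_ge0 ?sqr_ge0 ?std_complex_gaussian_pdf_ge0.
have mk : measurable_fun setT (fun u : R * R => (C%:E * ((h u.1)%:E * (h u.2)%:E))%E).
  apply: measurable_funeM; apply: emeasurable_funM.
    by apply: (measurableT_comp mh); exact: measurable_fst.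
  by apply: (measurableT_comp mh); exact: measurable_snd.
have k0 (u : R * R) : (0 <= C%:E * ((h u.1)%:E * (h u.2)%:E))%E.
  by rewrite mule_ge0 ?lee_fin// mulr_ge0// normal_pdf_ge0.
apply: (@le_trans _ _ (\int[mu \x mu]_u (C%:E * ((h u.1)%:E * (h u.2)%:E))))%E.
  apply: ge0_le_integral => //= -[x y] _.
  rewrite -!EFinM lee_fin /std_complex_gaussian_pdf/=.
  set q := x ^+ 2 + y ^+ 2; rewrite /sqr_dist0/= -/q.
  have q0 : 0 <= q by rewrite addr_ge0 ?sqr_ge0.
  (* Square of [q / 4 <= exp(q / 4)], whence the 16 in [C]. *)
  have e1 : q ^+ 2 <= 16 * expR (q / 2).
    have h1 := expR_ge1Dx (q / 4).
    have -> : q / 2 = q / 4 + q / 4 by field.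
    rewrite expRD; have : q / 4 <= expR (q / 4) by rewrite (le_trans _ h1)// lerDr.
    move=> h2; rewrite (_ : q ^+ 2 = 16 * (q / 4 * (q / 4))); last by field.
    by rewrite ler_wpM2l// ler_pM// divr_ge0.
  have -> : expR (- q) = expR (- (q / 2)) * expR (- (q / 2)).
    by rewrite -expRD; congr expR; field.
  have -> : C * (h x * h y) = 16 * (pi^-1 * expR (- (q / 2))).
    have -> : - (q / 2) = - (x ^+ 2 / 2) + - (y ^+ 2 / 2) by rewrite /q; field.
    by rewrite expRD !hE /C; ring.
  have e2 : expR (q / 2) * expR (- (q / 2)) = 1 by rewrite -expRD subrr expR0.
  rewrite [leLHS](_ : _ = (q ^+ 2 * expR (- (q / 2))) * (pi^-1 * expR (- (q / 2)))); last by ring.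
  rewrite ler_wpM2r ?mulr_ge0 ?invr_ge0 ?pi_ge0 ?expR_ge0//.
  rewrite (le_trans (ler_wpM2r (expR_ge0 _) e1))//.
  by rewrite -mulrA e2 mulr1.
rewrite fubini_tonelli1//.
have inner (x : R) : (\int[mu]_y (C%:E * ((h x)%:E * (h y)%:E)) = C%:E * (h x)%:E)%E.
  rewrite ge0_integralZl_EFin//.
  - rewrite ge0_integralZl_EFin ?normal_pdf_ge0//.
    by rewrite ih mule1.
  - by move=> y _; rewrite mule_ge0.
  - exact: measurable_funeM.
under eq_integral do rewrite /fubini_F/= inner.
by rewrite ge0_integralZl_EFin// ih mule1.
Qed.

End planar_gaussian.

(** * Laws and independence expressed through integrals *)

Section law_transfer.
Context {R : realType} d (T : measurableType d) (P : probability T R).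
Notation mu := (@lebesgue_measure R).

Lemma expectation_std_complex_gaussian (Z : T -> R[i]) (g : R * R -> R) :
  is_std_complex_gaussian P Z -> measurable_fun setT g -> (forall u, 0 <= g u) ->
  (\int[P]_w (g (coords (Z w)))%:E =
   \int[mu \x mu]_u (g u * std_complex_gaussian_pdf u)%:E)%E.
Proof.
move=> [mZ PZ] mg g0.
have mZ2 : @measurable_fun _ _ T (measurableTypeR R * measurableTypeR R)%type
  setT (coords \o Z) := mZ.
pose X : {mfun T >-> (measurableTypeR R * measurableTypeR R)%type} :=
  @mfun_Sub _ _ T (measurableTypeR R * measurableTypeR R)%type _ (mem_set mZ2).
have mgE : @measurable_fun _ _ (measurableTypeR R * measurableTypeR R)%type _
  setT (fun u => (g u)%:E).
  by apply/measurable_EFinP; exact: mg.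
have gE0 u : (0 <= (g u)%:E)%E by rewrite lee_fin.
rewrite -[LHS](@ge0_integral_distribution _ _ _ _ _ P X _ mgE gE0).
rewrite (@ge0_integral_density _ _ _ (mu \x mu)%E (distribution P X)
  _ (@measurable_std_complex_gaussian_pdf R) (@std_complex_gaussian_pdf_ge0 R) PZ _ mgE gE0).
by apply: eq_integral => u _; rewrite EFinM.
Qed.

(** Independence on rectangles identifies the joint law of the pair with the product of the two
    laws, by uniqueness of product measures; Tonelli then factors the integral. *)
Lemma independent_integralM (Z : nat -> T -> R[i]) (g : R * R -> R) j k :
  (forall i, measurable_fun setT (coords \o Z i)) ->
  mutually_independent P Z -> measurable_fun setT g -> (forall u, 0 <= g u) ->
  j != k ->
  (\int[P]_w (g (coords (Z j w)) * g (coords (Z k w)))%:E =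
   \int[P]_w (g (coords (Z j w)))%:E * \int[P]_w (g (coords (Z k w)))%:E)%E.
Proof.
move=> mZ indep mg g0 jk.
pose X i : {mfun T >-> (R * R)%type} := mfun_Sub (mem_set (mZ i)).
have mW : measurable_fun setT (fun w => (X j w, X k w)).
  by apply: measurable_fun_pair.
pose W : {mfun T >-> ((R * R) * (R * R))%type} := mfun_Sub (mem_set mW).
have mgE : measurable_fun setT (fun u => (g u)%:E) by exact/measurable_EFinP.
pose G (v : (R * R) * (R * R)) : \bar R := ((g v.1)%:E * (g v.2)%:E)%E.
have mG : measurable_fun setT G.
  apply: emeasurable_funM.
    by apply: (measurableT_comp mgE); exact: measurable_fst.
  by apply: (measurableT_comp mgE); exact: measurable_snd.
have G0 v : (0 <= G v)%E by rewrite mule_ge0 ?lee_fin.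
have lawW A : measurable A -> (distribution P (X j) \x distribution P (X k))%E A =
    distribution P W A.
  apply: product_measure_unique => B C mB mC.
  rewrite /distribution /pushforward /=.
  (* One family of sets has to carry both sides of the rectangle. Only its values at [j] and [k]
     enter, and they differ in index because [j != k]. *)
  have := indep [:: j; k] (fun i => if i == j then B else C).
  rewrite /= inE jk => /(_ isT).
  have mBC i : measurable (if i == j then B else C) by case: ifP.
  move=> /(_ mBC); rewrite big_cons big_seq1 eqxx eq_sym (negbTE jk).
  move=> <-; congr (P _); apply/seteqP; split => w /=.
    move=> [Bw Cw] i /=; rewrite !inE => /orP[/eqP->|/eqP->]; first by rewrite eqxx.
    by rewrite eq_sym (negbTE jk).
  move=> h; have := h j; have := h k; rewrite /= !inE !eqxx orbT eq_sym (negbTE jk).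
  by move=> /(_ isT) ? /(_ isT) ?.
have iX i : (\int[distribution P (X i)]_u (g u)%:E = \int[P]_w (g (coords (Z i w)))%:E)%E.
  by rewrite ge0_integral_distribution// => u; rewrite lee_fin.
transitivity (\int[distribution P W]_v G v)%E.
  by rewrite ge0_integral_distribution.
transitivity (\int[distribution P (X j) \x distribution P (X k)]_v G v)%E.
  by apply: eq_measure_integral => A mA _; exact/esym/lawW.
rewrite fubini_tonelli1// -!iX.
have g0E u : (0 <= (g u)%:E)%E by rewrite lee_fin.
transitivity (\int[distribution P (X j)]_u ((g u)%:E * \int[distribution P (X k)]_v (g v)%:E))%E.
  apply: eq_integral => u _; rewrite /fubini_F /G/=.
  by rewrite ge0_integralZl_EFin.
by rewrite ge0_integralZr// integral_ge0.
Qed.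

End law_transfer.

(** * Almost sure uniform convergence on compact sets *)

Theorem theorem2p4 (R : realType) (d : measure_display) (T : measurableType d)
    (P : probability T R) (zeta : nat -> T -> R[i])
    (zeta_gaussian : forall k, is_std_complex_gaussian P (zeta k))
    (zeta_indep : mutually_independent P zeta)
    (K : set R[i]^o) (K_compact : compact K) :
  {ae P, forall w,
    (forall N : nat, (0 < N)%N ->
       {within K, continuous (S_mean (zeta ^~ w) N : R[i]^o -> R)}) /\
    sup_norm K (fun z => S_mean (zeta ^~ w) N z - 1) @[N --> \oo] --> 0%E}.
Proof.
have UE n w : modulus (zeta n w) ^+ 2 = sqr_dist0 (coords (zeta n w)).
  by rewrite sqr_modulus.
have mq := @measurable_sqr_dist0 R; have q0 := @sqr_dist0_ge0 R.
have mzeta n : measurable_fun setT (coords \o zeta n) by case: (zeta_gaussian n).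
have mU n : measurable_fun setT (fun w => modulus (zeta n w) ^+ 2).
  under eq_fun do rewrite UE; exact: measurableT_comp mq (mzeta n).
have U0 n w : 0 <= modulus (zeta n w) ^+ 2 by exact: sqr_ge0.
have Eq n : (\int[P]_w (sqr_dist0 (coords (zeta n w)))%:E = 1)%E.
  by rewrite (expectation_std_complex_gaussian (zeta_gaussian n))// integral_sqr_dist0_pdf.
have EU n : (\int[P]_w (modulus (zeta n w) ^+ 2)%:E = 1)%E.
  by under eq_integral do rewrite UE; exact: Eq.
have [C HC] := @integral_sqr_dist0_sqr_pdf R.
have EU2 n : (\int[P]_w ((modulus (zeta n w) ^+ 2) ^+ 2)%:E <= C%:E)%E.
  under eq_integral do rewrite UE.
  rewrite (expectation_std_complex_gaussian (g := fun u => sqr_dist0 u ^+ 2)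
    (zeta_gaussian n))//.
    exact: measurable_funX.
  by move=> u; exact: sqr_ge0.
have EUU i j : i != j ->
    (\int[P]_w (modulus (zeta i w) ^+ 2 * modulus (zeta j w) ^+ 2)%:E = 1)%E.
  move=> ij; under eq_integral do rewrite !UE.
  by rewrite (independent_integralM mzeta zeta_indep mq q0 ij) !Eq mule1.
(* The exceptional null set is that of the strong law alone, so it depends neither on [K] nor on
   [N]; from here on [w] is fixed and the argument is deterministic. *)
have := strong_law mU U0 EU EU2 EUU; apply: filterS => w cvg_mean.
have [cont unif] := realization_uniform cvg_mean K_compact.
by split => // N _; exact: cont.
Qed.
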